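(* Let $F$ and $G$ be continuous distribution functions on $\mathbb{R}$ with $a_G<b_F$. Let $\mathcal{F}$ be a class of real-valued measurable functions on $\mathbb{R}$ with $\mathcal{F}\subseteq L^1(F)=\{\varphi:\int|\varphi(x)|\,F(dx)<\infty\}$, and suppose that $N_{[\,]}(\epsilon,\mathcal{F},L^1(F))<\infty$ for every $\epsilon>0$. Let $F_n$ be the Lynden-Bell estimator of $F$ based on $n$ left-truncated observations $(Y_i,T_i)$. Then, as $n\to\infty$, $$\sup_{\varphi\in\mathcal{F}}\left|\int\varphi\,d(F_n-F)\right|\longrightarrow 0\quad\text{a.s.}$$
   Context: Random left truncation model: $Y$ and $T$ are independent real random variables with distribution functions $F$ and $G$; $Y$ is the variable of interest and $T$ the left truncation variable. From $N$ i.i.d. copies of $(Y,T)$, a pair is observed only if $Y\ge T$; the observed pairs are denoted $(Y_i,T_i)$, $1\le i\le n$, so $n$ is binomial with parameters $N$ and $\alpha=P(Y\ge T)$. The law of an observed pair is the conditional law of $(Y,T)$ given $Y\ge T$: $H^*(y,t)=P(Y\le y,T\le t\mid Y\ge T)=\alpha^{-1}\int_{-\infty}^{y}G(t\wedge u)\,dF(u)$. For a distribution function $K$: $a_K=\inf\{x:K(x)>0\}$, $b_K=\sup\{x:K(x)<1\}$. Lynden-Bell estimator (no ties in the data): with $C_n(y)=\frac1n\sum_{i=1}^n I(T_i\le y\le Y_i)$, $$F_n(y)=1-\prod_{i:\,Y_i\le y}\frac{nC_n(Y_i)-1}{nC_n(Y_i)}.$$ Bracketing: for $l,u\in L^1(F)$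 the bracket $[l,u]$ is the set of functions $\varphi$ with $l\le\varphi\le u$; it is an $\epsilon$-bracket if $\int|u-l|\,dF<\epsilon$. $N_{[\,]}(\epsilon,\mathcal{F},L^1(F))$ is the minimum number of $\epsilon$-brackets needed to cover $\mathcal{F}$. Almost sure convergence of a possibly non-measurable supremum is understood as almost sure convergence of its measurable cover function.
   Formalization: The formal theorem adds the hypothesis a_G ≤ a_F. Without it the claim is false: for F=U(0,2), G=U(1,2) and the class {1_{(-∞,1]}}, F_n(1)=0 while F(1)=1/2; whenever a_G > a_F the indicator of (-∞,a_G] refutes it. *)

(* Defs.v *)
From HB Require Import structures.
From mathcomp Require Import all_boot all_order all_algebra.
From mathcomp Require Import all_classical all_reals all_analysis.
From mathcomp Require Import measurable_realfun.

Set Implicit Arguments.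
Unset Strict Implicit.
Unset Printing Implicit Defensive.
Import Order.TTheory GRing.Theory Num.Theory.
Import numFieldNormedType.Exports.

Local Open Scope classical_set_scope.
Local Open Scope ring_scope.

(* Endpoints are extended reals, so that unbounded supports are allowed.
   With F the law of Y and G that of T, the part of F to the left of
   [lower_endpoint G] is never observed: F can be recovered from truncated data
   only if [lower_endpoint G <= lower_endpoint F]. *)
Definition lower_endpoint (R : realType) (K : R -> R) : \bar R :=
  ereal_inf [set x%:E | x in [set x : R | 0 < K x]].

Definition upper_endpoint (R : realType) (K : R -> R) : \bar R :=
  ereal_sup [set x%:E | x in [set x : R | K x < 1]].

Definition independent_pair d (Omega : measurableType d) (R : realType)
    (P : probability Omega R) d1 (E1 : measurableType d1)
    d2 (E2 : measurableType d2) (X1 : Omega -> E1) (X2 : Omega -> E2) : Prop :=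
  forall (A1 : set E1) (A2 : set E2), measurable A1 -> measurable A2 ->
    P (X1 @^-1` A1 `&` X2 @^-1` A2) = (P (X1 @^-1` A1) * P (X2 @^-1` A2))%E.

Definition mutually_independent d (Omega : measurableType d) (R : realType)
    (P : probability Omega R) d' (E : measurableType d') (I : eqType)
    (X : I -> Omega -> E) : Prop :=
  forall (J : seq I) (A : I -> set E), uniq J ->
    (forall i, measurable (A i)) ->
    P (\bigcap_(i in [set` J]) (X i @^-1` A i)) =
      (\prod_(i <- J) P (X i @^-1` A i))%E.

Section lynden_bell.
Variable R : realType.
Implicit Types (s : seq (R * R)) (y : R).

(* In a sample [s], an entry [p] is a pair (Y_i, T_i): p.1 is the variable of
   interest and p.2 the truncation variable. *)
Definition risk_fraction s y : R :=
  (size s)%:R^-1 * \sum_(p <- s) (p.2 <= y <= p.1)%R%:R.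

Definition risk_count s y : R := (size s)%:R * risk_fraction s y.

Definition lynden_bell s y : R :=
  1 - \prod_(p <- s | p.1 <= y) ((risk_count s p.1 - 1) / risk_count s p.1).

Lemma lynden_bell_factor_itv s y : 0 <= (risk_count s y - 1) / risk_count s y <= 1.
Proof.
have [->|s0] := eqVneq s [::].
  by rewrite /risk_count /= mul0r invr0 mulr0 lexx ler01.
have sN0 : (size s)%:R != 0 :> R by rewrite pnatr_eq0 size_eq0.
have -> : risk_count s y = (\sum_(p <- s) nat_of_bool (p.2 <= y <= p.1)%R)%:R.
  by rewrite /risk_count /risk_fraction mulrA divff// mul1r natr_sum.
case: (\sum_(p <- s) _)%N => [|m]; first by rewrite invr0 mulr0 lexx ler01.
rewrite (_ : m.+1%:R - 1 = m%:R :> R); last by rewrite -natr1 addrK.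
by rewrite divr_ge0//= ler_pdivrMr ?ltr0n// mul1r ler_nat.
Qed.

Lemma lynden_bell_nondecreasing s : nondecreasing (lynden_bell s).
Proof.
move=> x y xy; rewrite /lynden_bell lerD2l lerN2.
rewrite big_mkcond [leRHS]big_mkcond /=.
apply: ler_prod => p _.
have /andP[c0 c1] := lynden_bell_factor_itv s p.1.
case: ifPn => py; case: ifPn => px; rewrite ?c0 ?c1 ?lexx ?ler01//.
by rewrite (le_trans px xy) in py.
Qed.

Lemma lynden_bell_right_continuous s : right_continuous (lynden_bell s).
Proof.
move=> y; apply: cvg_near_cst.
have H (r : seq (R * R)) :
    \forall z \near y^'+, all (fun p => (p.1 <= z) == (p.1 <= y)) r.
  elim: r => [|p r ih]; first by near=> z.
  have hp : \forall z \near y^'+, (p.1 <= z) == (p.1 <= y).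
    have [py|yp] := leP p.1 y; near=> z.
      by rewrite (le_trans py)//; near: z; exact: nbhs_right_ge.
    by rewrite eqbF_neg -ltNge; near: z; exact: nbhs_right_lt.
  by apply: filterS2 hp ih => z /= -> ->.
near=> z; rewrite /lynden_bell; congr (1 - _).
have /allP Hz : all (fun p => (p.1 <= z) == (p.1 <= y)) s by near: z; exact: H.
rewrite big_seq_cond [RHS]big_seq_cond; apply: eq_bigl => p.
by have [/Hz /eqP ->|] := boolP (p \in s).
Unshelve. all: by end_near. Qed.

HB.instance Definition _ s := isCumulative.Build R _ R (lynden_bell s)
  (@lynden_bell_nondecreasing s) (@lynden_bell_right_continuous s).

End lynden_bell.

Section truncated_sample.
Variables (Omega : Type) (R : realType) (Y T : nat -> Omega -> R).

(* The pairs that survive truncation among the first N latent pairs, listed in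
   order; the length of this list is the binomial sample size. *)
Definition observed_among (N : nat) (w : Omega) : seq (R * R) :=
  [seq (Y k w, T k w) | k <- iota 0 N & T k w <= Y k w].

(* The first n observed pairs: all N for which exactly n of the first N latent
   pairs are observed yield the same list, so the choice of N is immaterial.
   Should fewer than n pairs ever be observed, the sample is empty. *)
Definition truncated_sample (n : nat) (w : Omega) : seq (R * R) :=
  observed_among
    (xget 0%N [set N : nat | size (observed_among N w) = n]) w.

End truncated_sample.

Section bracketing.
Variables (R : realType) (mu : {measure set (measurableTypeR R) -> \bar R}).

(* Integrability includes Borel measurability. *)
Definition L1 : set (R -> R) :=
  [set phi | mu.-integrable [set: measurableTypeR R] (EFin \o phi)].

Definition bracket (l u : R -> R) : set (R -> R) :=
  [set phi | forall x, l x <= phi x <= u x].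

Definition is_bracket (eps : R) (l u : R -> R) : Prop :=
  [/\ L1 l, L1 u & (\int[mu]_x `|u x - l x|%:E < eps%:E)%E].

Definition covered_by_brackets (eps : R) (FF : set (R -> R)) (m : nat) : Prop :=
  exists l u : 'I_m -> R -> R, (forall i, is_bracket eps (l i) (u i)) /\
    FF `<=` \bigcup_(i in [set: 'I_m]) bracket (l i) (u i).

(* +oo when no finite family of brackets covers the class. *)
Definition bracketing_number (eps : R) (FF : set (R -> R)) : \bar R :=
  ereal_inf [set m%:R%:E | m in covered_by_brackets eps FF].

End bracketing.

(* The supremum is taken in [0, +oo], so that it is 0 over an empty class. *)
Definition sup_deviation (R : realType)
    (mu nu : {measure set (measurableTypeR R) -> \bar R})
    (FF : set (R -> R)) : \bar R :=
  maxe 0%E (ereal_sup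
    [set `| \int[mu]_x (phi x)%:E - \int[nu]_x (phi x)%:E |%E | phi in FF]).

Section measurable_cover.
Context d (Omega : measurableType d) (R : realType) (P : probability Omega R).

Definition is_measurable_cover (f g : Omega -> \bar R) : Prop :=
  [/\ measurable_fun [set: Omega] g,
      forall w, (f w <= g w)%E
    & forall h : Omega -> \bar R, measurable_fun [set: Omega] h ->
        {ae P, forall w, (f w <= h w)%E} -> {ae P, forall w, (g w <= h w)%E}].

(* Measurable covers are unique up to a null set, so the choice of [g] is
   immaterial. *)
Definition cover_cvg_ae0 (f : nat -> Omega -> \bar R) : Prop :=
  exists2 g : nat -> Omega -> \bar R,
    forall n, is_measurable_cover (f n) (g n)
    & {ae P, forall w, g n w @[n --> \oo] --> 0%E}.

End measurable_cover.

(* Main.v *)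
Require Import Defs.
From HB Require Import structures.
From mathcomp Require Import all_boot all_order all_algebra.
From mathcomp Require Import all_classical all_reals all_analysis.
From mathcomp Require Import measurable_realfun.
From mathcomp Require Import lra.

Set Implicit Arguments.
Unset Strict Implicit.
Unset Printing Implicit Defensive.
Import Order.TTheory GRing.Theory Num.Theory.
Import numFieldNormedType.Exports.

Local Open Scope classical_set_scope.
Local Open Scope ring_scope.

(* Write S(v) for 1 - F_n(v-) and R(v) for the size of the risk set at v, and
   index everything by the number N of latent pairs.  The ratio S/R is
   nonincreasing, so the mass S(Y)/R(Y) of F_n at an observation Y is at most
   1/R(Y), and at most 1/R(a) if a <= Y.  For phi >= 0 the integral of phi with
   respect to F_n is therefore at most the sum of phi(Y)/R(Y) over the
   observations Y <= a, plus N/R(a) times an ordinary mean of phi.  By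
   exchangeability, both sums are reverse supermartingales in N, with expectations
   bounded by a multiple of the integral of phi with respect to F, although 1/R is
   not bounded near the lower endpoint.  The maximal inequality then shows that
   the phi whose integrals converge a.s. form a closed subset of L^1(F).

   This set contains the indicators of rays: S/(1 - F) has asymptotic increments
   of order (H(t) - H(s))^2 with H = F + G, hence is asymptotically constant by
   bisection, and the maximal inequality shows that this constant is 1.  By a
   Dynkin class argument the set is all of L^1(F), and finitely many brackets
   reduce the supremum to finitely many integrals. *)

(** * The weights of the Lynden-Bell estimator *)

(** Two obstacles shape the proof. The sample of size [n] sits at a random number of latent pairs;
    it is however the list of observations among the first [N] of them for some [N >= n], and the
    latent pairs are exchangeable at every fixed length. All bounds are therefore sought for all
    large [N] at once, which is why maximal inequalities are used rather than bounds on single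
    expectations. The second obstacle is the lower endpoint of F, where G may tend to 0: there R/N
    is not uniformly comparable with its mean G(1 - F), so R cannot be replaced by that mean in
    phi(Y)/R(Y). Exchanging Y with an independent copy bounds the expectation of the sum with the
    random R kept as it is. Away from the lower endpoint R is of order N, and ordinary strong laws
    for rectangles suffice. *)

Section sample.
Variable R : realType.
Implicit Types (s : seq (R * R)) (v y : R) (p q : R * R).

Definition risk s v : R := \sum_(p <- s) (p.2 <= v <= p.1)%R%:R.

(* [1 - lynden_bell s] just before [v]: the observation at [v] is left out. *)
Definition surv s v : R :=
  \prod_(p <- s | p.1 < v) ((risk s p.1 - 1) / risk s p.1).

(** The atom of the estimator at [p.1]: what is left just before [p.1], times the proportion lost
    there. *)
Definition jump s p : R := surv s p.1 / risk s p.1.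

Lemma risk_countE s v : risk_count s v = risk s v.
Proof.
rewrite /risk_count /risk_fraction; have [->|s0] := eqVneq s [::].
  by rewrite /risk !big_nil mulr0 mulr0.
by rewrite mulrA divff ?mul1r// pnatr_eq0 size_eq0.
Qed.

Lemma risk_natE s v : risk s v = (\sum_(p <- s) nat_of_bool (p.2 <= v <= p.1)%R)%:R.
Proof. by rewrite /risk natr_sum. Qed.

Lemma risk_ge0 s v : 0 <= risk s v.
Proof. by rewrite risk_natE. Qed.

Lemma risk_ge1 s p : p \in s -> p.2 <= p.1 -> 1 <= risk s p.1.
Proof.
move=> ps p21; rewrite risk_natE (perm_big _ (perm_to_rem ps))/= big_cons.
by rewrite p21 lexx/= ler1n.
Qed.

Lemma factor_itv s v : 0 <= (risk s v - 1) / risk s v <= 1.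
Proof. by rewrite -risk_countE; exact: lynden_bell_factor_itv. Qed.

Lemma surv_ge0 s v : 0 <= surv s v.
Proof. by apply: prodr_ge0 => p _; have /andP[] := factor_itv s p.1. Qed.

Lemma surv_le1 s v : surv s v <= 1.
Proof.
suff /andP[] : 0 <= surv s v <= 1 by [].
apply: (@big_ind _ (fun x => 0 <= x <= 1)).
- by rewrite ler01 lexx.
- by move=> x y /andP[x0 x1] /andP[y0 y1]; rewrite mulr_ge0//= mulr_ile1.
- by move=> p _; exact: factor_itv.
Qed.

Lemma jump_ge0 s p : 0 <= jump s p.
Proof. by rewrite divr_ge0 ?surv_ge0 ?risk_ge0. Qed.

Lemma jump_le s p : jump s p <= (risk s p.1)^-1.
Proof. by rewrite ler_piMl ?invr_ge0 ?risk_ge0 ?surv_le1. Qed.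

(** After sorting by first component, the products over earlier observations are products over
    prefixes, and the sum telescopes. Without ties the order is strict, so [q.1 < p.1] selects
    exactly the prefix before [p]. *)
Lemma prod_telescope s (h : R * R -> R) : uniq (map fst s) ->
  1 - \prod_(p <- s) (1 - h p) =
  \sum_(p <- s) h p * \prod_(q <- s | q.1 < p.1) (1 - h q).
Proof.
pose e := fun p q : R * R => p.1 <= q.1.
have tote : total e by move=> p q; exact: le_total.
have tre : transitive e by move=> p q r; exact: le_trans.
move=> us; rewrite -(perm_big _ (permEl (perm_sort e s)))/=.
rewrite -[RHS](perm_big _ (permEl (perm_sort e s)))/=.
under [RHS]eq_bigr do rewrite -(perm_big _ (permEl (perm_sort e s)))/=.
have : uniq (map fst (sort e s)).
  by rewrite (perm_uniq (perm_map fst (permEl (perm_sort e s)))).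
have := sort_sorted tote s.
elim: (sort e s) => {s us}[_ _|p s ih /= pes /andP[ps us]].
  by rewrite !big_nil subrr.
have ples q : q \in s -> p.1 < q.1.
  move=> qs; have pq : p.1 <= q.1 := allP (order_path_min tre pes) _ qs.
  rewrite lt_neqAle pq andbT.
  by apply: contraNneq ps => ->; exact: map_f.
rewrite !big_cons ltxx/= [X in _ = _ * X + _]big1_seq ?mulr1; last first.
  move=> q /andP[qp qs]; have := ples _ qs.
  by rewrite ltNge (ltW qp).
rewrite -[X in _ = _ + X](_ : (1 - h p) * (1 - \prod_(j <- s) (1 - h j)) = _).
  by lra.
rewrite ih ?(path_sorted pes)// mulr_sumr.
rewrite big_seq [RHS]big_seq; apply: eq_bigr => q qs.
by rewrite big_cons ples// mulrCA.
Qed.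

(** Since [D] is closed downwards, everything before an observation in [D] is in [D], so filtering
    by [D] leaves the inner products unchanged. *)
Lemma prod_telescope_cond s (h : R * R -> R) (D : pred R) :
  (forall x y, x < y -> D y -> D x) ->
  uniq (map fst s) ->
  1 - \prod_(p <- s | D p.1) (1 - h p) =
  \sum_(p <- s | D p.1) h p * \prod_(q <- s | q.1 < p.1) (1 - h q).
Proof.
move=> Dd us; rewrite -big_filter -[RHS]big_filter prod_telescope; last first.
  by apply: subseq_uniq us; apply: map_subseq; exact: filter_subseq.
rewrite big_seq [RHS]big_seq; apply: eq_bigr => p; rewrite mem_filter => /andP[Dp _].
congr (_ * _); rewrite big_filter_cond; apply: eq_bigl => q.
by rewrite andb_idl// => /Dd; exact.
Qed.

Lemma factorE s p : p \in s -> p.2 <= p.1 ->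
  (risk s p.1 - 1) / risk s p.1 = 1 - (risk s p.1)^-1.
Proof.
move=> ps p21; rewrite mulrBl mul1r divff// gt_eqF//.
by rewrite (lt_le_trans ltr01)// risk_ge1.
Qed.

Lemma exists_max_fst s (a : pred (R * R)) : has a s ->
  exists2 p, p \in s /\ a p & {in s, forall q, a q -> q.1 <= p.1}.
Proof.
elim: s => [//|p s ih]; have [has_s _|has_s] := boolP (has a s); last first.
  rewrite /= (negbTE has_s) orbF => ap; exists p; first by rewrite mem_head.
  move=> q; rewrite inE => /orP[/eqP->//|qs] aq.
  by move/hasPn : has_s => /(_ _ qs); rewrite aq.
have [q [qs aq] qmax] := ih has_s.
have [/andP[ap qp]|/nandP h] := boolP (a p && (q.1 <= p.1)).
  exists p; first by rewrite mem_head.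
  move=> r; rewrite inE => /orP[/eqP->//|rs] ar.
  by rewrite (le_trans (qmax _ rs ar)).
exists q; first by rewrite inE qs orbT.
move=> r; rewrite inE => /orP[/eqP->|rs] ar; last exact: qmax.
by case: h; [rewrite ar|rewrite -ltNge => /ltW].
Qed.

Section truncated.
Variable s : seq (R * R).
Hypothesis us : uniq (map fst s).
Hypothesis trs : {in s, forall p, p.2 <= p.1}.

Let prod_factorE (D : pred R) :
  \prod_(p <- s | D p.1) ((risk s p.1 - 1) / risk s p.1) =
  \prod_(p <- s | D p.1) (1 - (risk s p.1)^-1).
Proof.
rewrite big_seq_cond [RHS]big_seq_cond; apply: eq_bigr => p /andP[ps _].
by rewrite factorE// trs.
Qed.

Lemma surv_telescope v : 1 - surv s v = \sum_(p <- s | p.1 < v) jump s p.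
Proof.
rewrite /surv (prod_factorE (fun y => y < v)) (prod_telescope_cond _ (D := fun y => y < v))//.
  by apply: eq_bigr => p _; rewrite /jump /surv mulrC (prod_factorE (fun y => y < p.1)).
by move=> x y xy yv; rewrite (lt_trans xy).
Qed.

Lemma lynden_bell_jump v : lynden_bell s v = \sum_(p <- s | p.1 <= v) jump s p.
Proof.
rewrite /lynden_bell; under eq_bigr do rewrite risk_countE.
rewrite (prod_factorE (fun y => y <= v)) (prod_telescope_cond _ (D := fun y => y <= v))//.
  by apply: eq_bigr => p _; rewrite /jump /surv mulrC (prod_factorE (fun y => y < p.1)).
by move=> x y xy yv; rewrite (le_trans (ltW xy)).
Qed.

(* The ratio [surv / risk] stays constant across an observation (both factors
   lose the proportion [1 / risk]) and decreases across a truncation time. *)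
Lemma surv_risk_le v1 v2 : v1 <= v2 ->
  surv s v2 * risk s v1 <= surv s v1 * risk s v2.
Proof.
(* Induction on the number of observations in [[v1, v2[], splitting off the last one. *)
have [n] := ubnP (count (fun p => v1 <= p.1 < v2) s).
elim: n v2 => // n ih v2 cn v12.
have [/exists_max_fst[p [ps /andP[v1p pv2] pmax]]|hasN] :=
    boolP (has (fun p => v1 <= p.1 < v2) s); last first.
  (* With no observation in between, [surv] is constant and the risk set can only gain members. *)
  have -> : surv s v2 = surv s v1.
    rewrite /surv big_seq_cond [RHS]big_seq_cond; apply: eq_bigl => q.
    have [qs/=|//] := boolP (q \in s).
    move/hasPn : hasN => /(_ _ qs); rewrite negb_and -ltNge -leNgt => /orP[qv1|v2q].
      by rewrite qv1 (lt_le_trans qv1).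
    by rewrite ltNge v2q ltNge (le_trans v12).
  rewrite ler_wpM2l ?surv_ge0// /risk big_seq_cond [leRHS]big_seq_cond.
  apply: ler_sum => q /andP[qs _]; rewrite ler_nat.
  have [/andP[qv1 v1q]/=|//] := boolP (q.2 <= v1 <= q.1).
  move/hasPn : hasN => /(_ _ qs); rewrite v1q/= -leNgt => ->.
  by rewrite (le_trans qv1 v12).
have {}ih : surv s p.1 * risk s v1 <= surv s v1 * risk s p.1.
  apply: ih => //; rewrite -ltnS; apply: leq_trans cn; rewrite ltnS.
  have pcount r : (count (fun q => v1 <= q.1 < p.1)%R r + count_mem p r <=
      count (fun q => v1 <= q.1 < v2)%R r)%N.
    elim: r => //= q r ihr; rewrite addnACA leq_add//.
    have [->|qp] := eqVneq q p; first by rewrite ltxx andbF v1p pv2.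
    rewrite addn0; case: (v1 <= q.1) => //=.
    by case: ltP => // /lt_trans -> .
  apply: leq_trans (pcount s); rewrite -addn1 leq_add2l.
  by rewrite -has_count has_pred1.
have r1 := risk_ge1 ps (trs ps).
have -> : surv s v2 = surv s p.1 * (1 - (risk s p.1)^-1).
  rewrite -factorE ?trs// /surv (perm_big _ (perm_to_rem ps))/= big_cons pv2 mulrC.
  congr (_ * _); rewrite [RHS](perm_big _ (perm_to_rem ps))/= big_cons ltxx.
  rewrite big_seq_cond [RHS]big_seq_cond; apply: eq_bigl => q.
  have [qs/=|//] := boolP (q \in rem p s).
  have qs' := mem_rem qs.
  have qp : q.1 != p.1.
    have := us; rewrite (perm_uniq (perm_map fst (perm_to_rem ps)))/= => /andP[pN _].
    by apply: contraNneq pN => <-; exact: map_f.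
  apply/idP/idP => [qv2|/lt_trans]; last exact.
  rewrite lt_neqAle qp/= leNgt; apply/negP => pq.
  have := pmax _ qs'; rewrite qv2 (le_trans v1p (ltW pq)) => /(_ isT).
  by rewrite leNgt pq.
(* No observation lies strictly between [p.1] and [v2], so of those at risk at [p.1] only [p] itself
   has left by [v2]. *)
have rv2 : risk s p.1 - 1 <= risk s v2.
  rewrite /risk (perm_big _ (perm_to_rem ps))/= big_cons trs// lexx/=.
  rewrite addrC addrK [leRHS](perm_big _ (perm_to_rem ps))/= big_cons.
  rewrite -[leLHS]add0r lerD// big_seq_cond [leRHS]big_seq_cond.
  apply: ler_sum => q /andP[qs _]; rewrite ler_nat.
  have [/andP[qp pq]/=|//] := boolP (q.2 <= p.1 <= q.1).
  rewrite (le_trans qp (ltW pv2))/= leNgt lt0b.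
  apply/negP => qv2.
  have := pmax _ (mem_rem qs); rewrite qv2 (le_trans v1p pq) => /(_ isT) qp1.
  have := us; rewrite (perm_uniq (perm_map fst (perm_to_rem ps)))/= => /andP[/negP + _].
  by apply; rewrite (_ : p.1 = q.1) ?map_f//; apply/eqP; rewrite eq_le pq qp1.
rewrite mulrAC (le_trans (ler_wpM2r _ ih))//.
  by rewrite subr_ge0 invf_le1// (lt_le_trans ltr01).
rewrite -mulrA ler_wpM2l ?surv_ge0// mulrBr mulr1 divff//.
by rewrite gt_eqF// (lt_le_trans ltr01).
Qed.

Lemma jump_risk_le1 p a : p \in s -> a <= p.1 -> jump s p * risk s a <= 1.
Proof.
move=> ps ap; rewrite /jump mulrAC ler_pdivrMr; last first.
  by rewrite (lt_le_trans ltr01)// risk_ge1// trs.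
rewrite (le_trans (surv_risk_le ap))// mul1r ler_piMl ?risk_ge0//.
exact: surv_le1.
Qed.

Lemma surv_increment v1 v2 : v1 <= v2 ->
  surv s v1 - surv s v2 = \sum_(p <- s | v1 <= p.1 < v2) jump s p.
Proof.
move=> v12; rewrite -[LHS](_ : (1 - surv s v2) - (1 - surv s v1) = _); last by lra.
rewrite !surv_telescope [X in X - _](bigID (fun p => p.1 < v1))/=.
rewrite addrC -[X in _ + X - _](_ : \sum_(p <- s | p.1 < v1) jump s p = _).
  rewrite addrK; apply: eq_bigl => p; rewrite -leNgt andbC//.
by apply: eq_bigl => p; rewrite andb_idl// => /lt_le_trans; apply.
Qed.

(** Each jump in [[v1, v2[] is a value of [surv / risk], hence lies between the values of this ratio
    at [v2] and at [v1]. The bounds are multiplied out, so that the risk may vanish at the two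
    ends. *)
Lemma surv_increment_bounds v1 v2 : v1 <= v2 ->
  let A := \sum_(p <- s) (v1 <= p.1 < v2)%R%:R in
  surv s v2 * A <= (surv s v1 - surv s v2) * risk s v2 /\
  (surv s v1 - surv s v2) * risk s v1 <= surv s v1 * A.
Proof.
move=> v12 A; rewrite surv_increment// !mulr_suml !mulr_sumr.
have r0 p : p \in s -> 0 < risk s p.1.
  by move=> ps; rewrite (lt_le_trans ltr01)// risk_ge1// trs.
split; first rewrite [leRHS]big_mkcond/= big_seq [leRHS]big_seq.
  apply: ler_sum => p ps; case: ifPn => [/andP[v1p pv2]|_]; last by rewrite mulr0.
  rewrite mulr1 /jump mulrAC ler_pdivlMr ?r0//.
  by rewrite surv_risk_le// ltW.
rewrite [leLHS]big_mkcond/= big_seq [leRHS]big_seq.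
apply: ler_sum => p ps; case: ifPn => [/andP[v1p pv2]|_]; last by rewrite mulr0.
by rewrite mulr1 /jump mulrAC ler_pdivrMr ?r0// surv_risk_le.
Qed.

End truncated.

End sample.

(** * Integrals with respect to the estimator as finite weighted sums *)

Section lynden_bell_integral.
Variables (R : realType) (s : seq (R * R)).
Hypothesis us : uniq (map fst s).
Hypothesis trs : {in s, forall p, p.2 <= p.1}.

Definition estimate (phi : R -> R) : R := \sum_(p <- s) jump s p * phi p.1.

Let atom i : {measure set (measurableTypeR R) -> \bar R} :=
  mscale (NngNum (jump_ge0 s (nth (0, 0) s i)))
    (@dirac _ (measurableTypeR R) (nth (0, 0) s i).1 R).

(** On []a, b]] both sides are the sum of the jumps at the observations in []a, b]]; these intervals
    determine the measure. *)
Lemma lebesgue_stieltjes_lynden_bell (A : set (measurableTypeR R)) :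
  measurable A ->
  lebesgue_stieltjes_measure (lynden_bell s) A = msum atom (size s) A.
Proof.
apply: lebesgue_stieltjes_measure_unique => I [[a b]]/= _ <-.
rewrite /lebesgue_stieltjes_measure /measure_extension/=.
rewrite measurable_mu_extE/=; last exact: is_ocitv.
have [ab|ba] := leP a b; last first.
  by rewrite set_itv_ge ?wlength0 ?measure0// bnd_simp -leNgt ltW.
rewrite wlength_itv_bnd// /msum/=.
transitivity (\sum_(i < size s) (jump s (nth (0, 0) s i) *
    ((nth (0, 0) s i).1 \in `]a, b])%:R)%:E)%E; last first.
  by apply: eq_bigr => i _; rewrite /atom /mscale/= diracE mem_setE EFinM.
rewrite sumEFin; congr (_%:E).
rewrite -(big_mkord xpredT (fun i => jump s (nth (0, 0) s i) *
    ((nth (0, 0) s i).1 \in `]a, b])%:R)).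
rewrite -(big_nth (0, 0) xpredT (fun p => jump s p * (p.1 \in `]a, b])%:R)).
rewrite !lynden_bell_jump// [X in X - _](bigID (fun p => p.1 <= a))/=.
rewrite -[X in X + _ - _](_ : \sum_(p <- s | p.1 <= a) jump s p = _); last first.
  by apply: eq_bigl => p; rewrite andb_idl// => /le_trans; apply.
rewrite [X in X - _]addrC addrK big_mkcond/=; apply: eq_bigr => p _.
by rewrite in_itv/= -ltNge andbC; case: ifP => _; rewrite ?mulr1 ?mulr0.
Qed.

Let ge0_integral_lynden_bell (phi : R -> \bar R) :
  measurable_fun [set: measurableTypeR R] phi -> (forall x, 0 <= phi x)%E ->
  (\int[lebesgue_stieltjes_measure (lynden_bell s)]_x phi x =
   \sum_(p <- s) (jump s p)%:E * phi p.1)%E.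
Proof.
move=> mphi phi0; rewrite (eq_measure_integral (msum atom (size s))); last first.
  by move=> A mA _; exact: lebesgue_stieltjes_lynden_bell.
rewrite ge0_integral_measure_sum// (big_nth (0, 0)) big_mkord.
apply: eq_bigr => i _; rewrite ge0_integral_mscale//=.
by rewrite integral_dirac// diracT mul1e.
Qed.

Lemma integral_lynden_bell (phi : R -> R) :
  measurable_fun [set: measurableTypeR R] phi ->
  (\int[lebesgue_stieltjes_measure (lynden_bell s)]_x (phi x)%:E =
   (estimate phi)%:E)%E.
Proof.
move=> mphi; have mphi' := (measurable_EFinP _ _).2 mphi.
rewrite integralE !ge0_integral_lynden_bell//; last 2 first.
- exact: measurable_funeneg.
- exact: measurable_funepos.
transitivity (\sum_(p <- s) jump s p * Num.max (phi p.1) 0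
              - \sum_(p <- s) jump s p * Num.max (- phi p.1) 0)%:E; last first.
  rewrite /estimate -sumrB; congr (_%:E); apply: eq_bigr => p _.
  rewrite -mulrBr; congr (_ * _).
  have [h|/ltW h] := leP (phi p.1) 0.
    by rewrite max_l ?oppr_ge0//; lra.
  by rewrite max_r ?oppr_le0//; lra.
rewrite EFinB -!sumEFin; congr (_ - _)%E.
  by apply: eq_bigr => p _; rewrite funeposE [RHS]EFinM; congr (_ * _)%E; exact/esym/EFin_max.
by apply: eq_bigr => p _; rewrite funenegE [RHS]EFinM; congr (_ * _)%E; exact/esym/EFin_max.
Qed.

End lynden_bell_integral.

Section estimate_linear.
Variable R : realType.

Lemma estimateD s (phi psi : R -> R) :
  estimate s (fun y => phi y + psi y) = estimate s phi + estimate s psi.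
Proof. by rewrite /estimate -big_split/=; apply: eq_bigr => p _; rewrite mulrDr. Qed.

Lemma estimateZ s c (phi : R -> R) :
  estimate s (fun y => c * phi y) = c * estimate s phi.
Proof. by rewrite /estimate mulr_sumr; apply: eq_bigr => p _; rewrite mulrCA. Qed.

Lemma ler_estimate s (phi psi : R -> R) : (forall y, phi y <= psi y) ->
  estimate s phi <= estimate s psi.
Proof. by move=> h; apply: ler_sum => p _; rewrite ler_wpM2l ?jump_ge0. Qed.

Lemma estimate_dist s (phi psi : R -> R) :
  `|estimate s phi - estimate s psi| <= estimate s (fun y => `|phi y - psi y|).
Proof.
have -> : estimate s phi - estimate s psi = estimate s (fun y => phi y - psi y).
  by rewrite /estimate -sumrB; apply: eq_bigr => p _; rewrite mulrBr.
rewrite (le_trans (ler_norm_sum _ _ _))//; apply: ler_sum => p _.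
by rewrite normrM ger0_norm ?jump_ge0.
Qed.

End estimate_linear.

(** * Exchangeability and a maximal inequality *)

Section path_space.
Variable R : realType.

Definition rectangle (M : nat) (B C : nat -> set R) : set (nat -> R * R) :=
  [set x | forall k, (k < M)%N -> B k (x k).1 /\ C k (x k).2].

Definition rectangles : set (set (nat -> R * R)) :=
  [set A | exists M B C, [/\ forall k, measurable (B k),
    forall k, measurable (C k) & A = rectangle M B C]].

(** The countable product sigma-algebra, generated by a family closed under intersection, so that
    laws of sequences need only be compared on finite rectangles. *)
Definition path_space : Type := g_sigma_algebraType rectangles.
HB.instance Definition _ := Measurable.on path_space.

Lemma rectangles_setI : setI_closed rectangles.
Proof.
move=> _ _ [M [B [C [mB mC ->]]]] [M' [B' [C' [mB' mC' ->]]]].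
(* Full sides extend both rectangles to the common length [maxn M M']. *)
pose cut N (D : nat -> set R) k := if (k < N)%N then D k else setT.
have mcut N D : (forall k, measurable (D k)) -> forall k, measurable (cut N D k).
  by move=> mD k; rewrite /cut; case: ifP.
exists (maxn M M'), (fun k => cut M B k `&` cut M' B' k),
  (fun k => cut M C k `&` cut M' C' k); split.
- by move=> k; apply: measurableI; exact: mcut.
- by move=> k; apply: measurableI; exact: mcut.
apply/seteqP; split => [x [h h'] k _|x h]; rewrite /cut.
  split; split; case: ifPn => // kM.
  - by have [] := h k kM.
  - by have [] := h' k kM.
  - by have [] := h k kM.
  - by have [] := h' k kM.
split => k kM; have := h k; rewrite /cut leq_max kM ?orbT => /(_ isT)[[? ?] [? ?]] //.
Qed.

Lemma measurable_rectangle M (B C : nat -> set R) :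
  (forall k, measurable (B k)) -> (forall k, measurable (C k)) ->
  measurable (rectangle M B C : set path_space).
Proof. by move=> mB mC; apply: sub_sigma_algebra; exists M, B, C. Qed.

Lemma measurable_coord k :
  measurable_fun [set: path_space] (fun x : path_space => x k : R * R).
Proof.
apply/measurable_fun_pairP; split => _ A mA; rewrite setTI.
  rewrite (_ : _ @^-1` _ =
    rectangle k.+1 (fun j => if j == k then A else setT) (fun=> setT)).
    by apply: measurable_rectangle => // j; case: ifP.
  apply/seteqP; split => x /=; first by move=> Ax j _; case: eqP => [->|].
  by move=> /(_ k (ltnSn k))[]; rewrite eqxx.
rewrite (_ : _ @^-1` _ =
  rectangle k.+1 (fun=> setT) (fun j => if j == k then A else setT)).
  by apply: measurable_rectangle => // j; case: ifP.
apply/seteqP; split => x /=; first by move=> Ax j _; case: eqP => [->|].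
by move=> /(_ k (ltnSn k))[_]; rewrite eqxx.
Qed.

Lemma measurable_path d (T : measurableType d) (X : T -> nat -> R * R) :
  (forall k, measurable_fun [set: T] (X ^~ k)) ->
  measurable_fun [set: T] (X : T -> path_space).
Proof.
move=> mX; apply: (@measurability _ _ _ path_space _ _ rectangles) => //.
move=> _ [_ [M [B [C [mB mC ->]]]] <-].
rewrite setTI (_ : _ @^-1` _ = \bigcap_(k in `I_M)
    ((fst \o X ^~ k) @^-1` B k `&` (snd \o X ^~ k) @^-1` C k)).
  apply: bigcap_measurableType => k _; apply: measurableI.
    by rewrite -[_ @^-1` _]setTI; apply: measurableT_comp.
  by rewrite -[_ @^-1` _]setTI; apply: measurableT_comp.
by apply/seteqP; split => w /=; move=> h k; exact: h.
Qed.

(** Two measures are allowed because this serves both for exchangeability, under a single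
    probability, and for independence, where a restricted probability is compared with a scaled
    one. *)
Lemma eq_integral_path d1 d2 (T1 : measurableType d1) (T2 : measurableType d2)
    (m1 : {measure set T1 -> \bar R}) (m2 : {measure set T2 -> \bar R})
    (X1 : T1 -> path_space) (X2 : T2 -> path_space) (h : path_space -> \bar R) :
  (m1 setT < +oo)%E ->
  measurable_fun setT X1 -> measurable_fun setT X2 ->
  (forall M B C, (forall k, measurable (B k)) -> (forall k, measurable (C k)) ->
    m1 (X1 @^-1` rectangle M B C) = m2 (X2 @^-1` rectangle M B C)) ->
  measurable_fun setT h -> (forall x, 0 <= h x)%E ->
  (\int[m1]_w h (X1 w) = \int[m2]_w h (X2 w))%E.
Proof.
move=> m1oo mX1 mX2 m12 mh h0.
pose X1' : {mfun T1 >-> path_space} :=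
  HB.pack X1 (isMeasurableFun.Build _ _ _ _ _ mX1).
pose X2' : {mfun T2 >-> path_space} :=
  HB.pack X2 (isMeasurableFun.Build _ _ _ _ _ mX2).
rewrite -[LHS](ge0_integral_pushforward mX1 m1 measurableT mh)//.
rewrite -[RHS](ge0_integral_pushforward mX2 m2 measurableT mh)//.
apply: eq_measure_integral => A mA _.
have := (@measure_unique _ R path_space rectangles (fun=> setT) erefl rectangles_setI).
move=> /(_ _ _ (pushforward m1 X1') (pushforward m2 X2')); apply => //.
- move=> _; exists 0%N, (fun=> setT), (fun=> setT); split => //.
  by apply/seteqP; split.
- by rewrite bigcup_const.
- by move=> _ [M [B [C [mB mC ->]]]]; exact: m12.
Qed.

End path_space.

Definition swap (i j k : nat) : nat :=
  if k == i then j else if k == j then i else k.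

Lemma swapK i j : involutive (swap i j).
Proof.
move=> k; rewrite /swap; case: (k =P i) => [ki|/eqP ki].
  by rewrite eqxx ki; case: eqP.
case: (k =P j) => [kj|/eqP kj]; first by rewrite eqxx kj.
by rewrite (negbTE ki) (negbTE kj).
Qed.

Lemma swap_lt i j M k : (i < M)%N -> (j < M)%N -> (k < M)%N -> (swap i j k < M)%N.
Proof. by move=> iM jM kM; rewrite /swap; case: ifP => // _; case: ifP. Qed.

Lemma perm_map_involutive (s : nat -> nat) M : involutive s ->
  (forall k, (k < M)%N -> (s k < M)%N) ->
  perm_eq (map s (iota 0 M)) (iota 0 M).
Proof.
move=> sK sM; apply: uniq_perm => [| |k]; rewrite ?iota_uniq//.
  by rewrite map_inj_uniq ?iota_uniq//; exact: inv_inj.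
rewrite mem_iota/=; apply/mapP/idP => [[j]|kM].
  by rewrite mem_iota/= => jM ->; exact: sM.
by exists (s k); rewrite ?mem_iota ?sM// sK.
Qed.

Section exchangeable.
Variables (R : realType) (d : measure_display) (Omega : measurableType d).
Variables (P : probability Omega R) (Y T : nat -> {RV P >-> R}).
Variables mu nu : set R -> \bar R.
Hypothesis YT : forall k, independent_pair P (Y k) (T k).
Hypothesis indep : mutually_independent P (fun k w => (Y k w, T k w) : R * R).
Hypothesis Ymu : forall k A, measurable A -> P (Y k @^-1` A) = mu A.
Hypothesis Tnu : forall k A, measurable A -> P (T k @^-1` A) = nu A.

Definition latent (w : Omega) : path_space R := fun k => (Y k w, T k w).

Lemma measurable_latent_perm (s t : nat -> nat) :
  measurable_fun setT (fun w => (fun k => (Y (s k) w, T (t k) w)) : path_space R).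
Proof.
apply: measurable_path => k.
by apply/measurable_fun_pairP; split; exact: measurable_funPT.
Qed.

Lemma measurable_latent : measurable_fun setT latent.
Proof. exact: (measurable_latent_perm id id). Qed.

Lemma latent_rectangle M (B C : nat -> set R) :
  (forall k, measurable (B k)) -> (forall k, measurable (C k)) ->
  P (latent @^-1` rectangle M B C) =
  (\prod_(k <- iota 0 M) (mu (B k) * nu (C k)))%E.
Proof.
move=> mB mC; rewrite (_ : _ @^-1` _ =
    \bigcap_(k in [set` iota 0 M]) ((fun w => (Y k w, T k w)) @^-1` (B k `*` C k))).
  rewrite indep ?iota_uniq//; last by move=> k; exact: measurableX.
  by apply: eq_bigr => k _; rewrite -(@Ymu k)// -(@Tnu k)// -YT.
by apply/seteqP; split => w /= h k; have := h k; rewrite /= mem_iota.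
Qed.

(** The probability of a rectangle is a product over all sides, and Y and T are independent within
    each pair; hence the two coordinates may be permuted by different involutions. Permuting Y alone
    is what the bound on expectations below requires. *)
Lemma integral_latent_perm (s t : nat -> nat) (M0 : nat)
    (h : path_space R -> \bar R) :
  involutive s -> involutive t ->
  (forall M k, (M0 <= M)%N -> (k < M)%N -> (s k < M)%N) ->
  (forall M k, (M0 <= M)%N -> (k < M)%N -> (t k < M)%N) ->
  measurable_fun setT h -> (forall x, 0 <= h x)%E ->
  (\int[P]_w h (fun k => (Y (s k) w, T (t k) w)) = \int[P]_w h (latent w))%E.
Proof.
move=> sK tK sM tM mh h0; apply: eq_integral_path => //.
- by rewrite -ge0_fin_numE// fin_num_measure.
- exact: measurable_latent_perm.
- exact: measurable_latent.
move=> M B C mB mC.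
(* Padding with full sides up to a length at least [M0] makes [s] and [t] permute the sides of the
   rectangle. *)
pose cut (D : nat -> set R) k := if (k < M)%N then D k else setT.
have mcut D : (forall k, measurable (D k)) -> forall k, measurable (cut D k).
  by move=> mD k; rewrite /cut; case: ifP.
pose N := maxn M M0.
have rectE : rectangle M B C = rectangle N (cut B) (cut C).
  apply/seteqP; split => x xr k kM; rewrite /cut.
    by case: ifP => // /xr.
  have kN : (k < N)%N by rewrite leq_max kM.
  by have := xr k kN; rewrite /cut kM.
have N0 : (M0 <= N)%N by rewrite leq_maxr.
rewrite rectE [RHS]latent_rectangle; [|exact: mcut|exact: mcut].
rewrite (_ : _ @^-1` _ = latent @^-1` rectangle N (cut B \o s) (cut C \o t)).
  transitivity (\prod_(k <- iota 0 N) (mu (cut B (s k)) * nu (cut C (t k))))%E.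
    by apply: latent_rectangle => k; exact: mcut.
  rewrite !big_split/= -[in LHS](big_map s xpredT (mu \o cut B)).
  rewrite -[X in (_ * X)%E](big_map t xpredT (nu \o cut C)).
  by rewrite !(perm_big _ (perm_map_involutive _ _))//=; move=> k; [exact: tM|exact: sM].
apply/seteqP; split => w /= wr k kN; split.
- by have [] := wr _ (sM _ _ N0 kN); rewrite /= sK.
- by have [] := wr _ (tM _ _ N0 kN); rewrite /= tK.
- by have [] := wr _ (sM _ _ N0 kN); rewrite /= sK.
- by have [] := wr _ (tM _ _ N0 kN); rewrite /= tK.
Qed.

End exchangeable.

(** * Averages weighted by inverse risk *)

Section risk_average.
Variables (R : realType) (E : Type) (g : E -> R) (r : E -> E -> bool).

(** With [r] the relation of being at risk this is the sum of phi(Y)/R(Y); with [r] constantly true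
    it is the ordinary mean. A list of indices, rather than their number, allows indices to be left
    out and permuted. *)
Definition risk_average (s : seq nat) (x : nat -> E) : R :=
  \sum_(k <- s) g (x k) / \sum_(l <- s) (r (x k) (x l))%:R.

Lemma perm_risk_average s t x : perm_eq s t ->
  risk_average s x = risk_average t x.
Proof.
move=> st; rewrite /risk_average (perm_big _ st)/=.
by apply: eq_bigr => k _; rewrite (perm_big _ st).
Qed.

Lemma risk_average_comp s x (f : nat -> nat) :
  risk_average s (x \o f) = risk_average (map f s) x.
Proof.
by rewrite /risk_average big_map; apply: eq_bigr => k _; rewrite big_map.
Qed.

Hypothesis g0 : forall z, 0 <= g z.
Hypothesis gr : forall z, g z != 0 -> r z z.

Lemma risk_average_ge0 s x : 0 <= risk_average s x.
Proof. by apply: sumr_ge0 => k _; rewrite divr_ge0 ?sumr_ge0. Qed.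

(* For an exchangeable sequence this makes the risk averages over the first
   [N] indices a reverse supermartingale. *)
Lemma leave_one_out s x : uniq s ->
  \sum_(j <- s) risk_average (rem j s) x <= (size s)%:R * risk_average s x.
Proof.
move=> us; rewrite /risk_average.
have bigrem j (G : nat -> R) : \sum_(k <- rem j s) G k = \sum_(k <- s | k != j) G k.
  by rewrite rem_filter// big_filter.
under eq_bigr do rewrite bigrem.
rewrite (exchange_big_dep xpredT)//= mulr_sumr big_seq [leRHS]big_seq.
apply: ler_sum => k ks.
under eq_bigr do rewrite bigrem.
have [->|gk] := eqVneq (g (x k)) 0.
  by rewrite mul0r mulr0 big1// => j _; rewrite mul0r.
rewrite -mulr_sumr mulrCA ler_wpM2l//.
pose n := (\sum_(l <- s) r (x k) (x l))%N.
have nE : \sum_(l <- s) (r (x k) (x l))%:R = n%:R :> R by rewrite natr_sum.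
have n_gt0 : (0 < n)%N.
  by rewrite /n (bigD1_seq k)//= gr.
rewrite nE.
(* Leaving out [j] turns the count [n] into [n - 1] if [j] is counted and keeps it otherwise; the
   form affine in the indicator can be summed over [j]. *)
have E1 j : j \in s -> (\sum_(l <- s | l != j) (r (x k) (x l))%:R)^-1 =
    (r (x k) (x j))%:R / (n%:R - 1) + (1 - (r (x k) (x j))%:R) / n%:R :> R.
  move=> js; rewrite -nE (bigD1_seq j js us)/=.
  by case: (r _ _); rewrite ?mul0r ?mul1r ?subrr ?mul0r ?addr0 ?add0r ?subr0 ?mul1r// addrC addrK.
rewrite big_seq_cond (eq_bigr (fun j => (r (x k) (x j))%:R / (n%:R - 1) +
    (1 - (r (x k) (x j))%:R) / n%:R)); last by move=> j /andP[js _]; exact: E1.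
rewrite -big_seq_cond big_split/= -!mulr_suml.
have S1 : \sum_(j <- s | k != j) (r (x k) (x j))%:R = n%:R - 1 :> R.
  rewrite -nE (bigD1_seq k ks us)/= gr// [1 + _]addrC addrK.
  by apply: eq_bigl => j; rewrite eq_sym.
have S2 : \sum_(j <- s | k != j) (1 - (r (x k) (x j))%:R) = (size s)%:R - n%:R :> R.
  rewrite sumrB S1 opprB addrCA addrA; congr (_ - _).
  have -> : (size s)%:R = \sum_(j <- s) 1 :> R by rewrite big_const_seq count_predT iter_addr_0.
  rewrite [RHS](bigD1_seq k ks us)/=; congr (_ + _).
  by apply: eq_bigl => j; rewrite eq_sym.
rewrite S1 S2 [X in _ + X]mulrBl [X in _ + (_ - X)]divff ?pnatr_eq0 ?gt_eqF// addrCA gerDl.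
(* Equality holds unless [k] is the only index counted; then [0 / 0 = 0] and the inequality is
   strict. *)
have [->|n1] := eqVneq (n%:R : R) 1; first by rewrite subrr mul0r sub0r lerN10.
by rewrite divff ?subrr// subr_eq0.
Qed.

End risk_average.

(** * The maximal inequality in reversed time *)

Section maximal.
Variables (R : realType) (d : measure_display) (Omega : measurableType d).
Variables (P : probability Omega R) (f : nat -> Omega -> R) (a : R).
Hypothesis mf : forall n, measurable_fun setT (f n).
Hypothesis f0 : forall n w, 0 <= f n w.
Hypothesis a0 : 0 < a.

Definition below (m M : nat) : set Omega :=
  [set w | forall n, (m <= n <= M)%N -> f n w < a].

Lemma measurable_below m M : measurable (below m M).
Proof.
rewrite (_ : below m M = \bigcap_(n in [set n | (m <= n <= M)%N])
    (f n @^-1` `]-oo, a[)).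
  apply: bigcap_measurableType => n _; rewrite -[_ @^-1` _]setTI.
  exact: mf.
by apply/seteqP; split => w /= h n /h; rewrite /= in_itv.
Qed.

Let mf' n D : measurable_fun D (EFin \o f n).
Proof. by apply/measurable_EFinP; apply: measurable_funTS. Qed.

(** Stopping in reversed time: [C] is the event that [n] is the last index up to [M] with
    [a <= f n]. It moves from the integral to the exceedance probability at the price [a <= f n]. *)
Let below_split n M : (n <= M)%N ->
  (\int[P]_(w in below n M) (f n w)%:E + a%:E * P (~` below n M) <=
   \int[P]_(w in below n.+1 M) (f n w)%:E + a%:E * P (~` below n.+1 M))%E.
Proof.
move=> nM; pose C := below n.+1 M `&` [set w | a <= f n w].
have mC : measurable C.
  apply: measurableI; first exact: measurable_below.
  rewrite -[X in measurable X]setTI (_ : [set w | _] = f n @^-1` `[a, +oo[).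
    exact: mf.
  by apply/seteqP; split => w /=; rewrite in_itv/= andbT.
have bE : below n.+1 M = below n M `|` C.
  apply/seteqP; split => [w h|w [h|[//]]].
    have [fa|fa] := ltP (f n w) a; last by right.
    left => k; rewrite leq_eqVlt => /andP[/orP[/eqP<-//|nk] kM].
    by apply: h; rewrite nk.
  by move=> k /andP[nk kM]; apply: h; rewrite (ltnW nk).
have dC : [disjoint below n M & C].
  apply/disj_set2P; rewrite -subset0 => w [h [_ /=]].
  by rewrite leNgt h ?leqnn.
have bCE : ~` below n M = ~` below n.+1 M `|` C.
  rewrite bE setCU setUIl [in X in _ `&` X]setUC setUv setIT.
  apply/esym/setUidl => w Cw bw; move/disj_set2P : dC.
  by rewrite -subset0 => /(_ w); apply; split.
rewrite [X in (_ <= X + _)%E](_ : _ =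
  \int[P]_(w in below n M `|` C) (EFin \o f n) w)%E; last by rewrite -bE.
rewrite ge0_integral_setU//=;
  [|exact: measurable_below|by move=> w _; rewrite lee_fin].
rewrite -[leRHS]addeA; apply: leeD2l.
rewrite bCE measureU//; last 2 first.
- exact: measurableC (measurable_below _ _).
- by apply/seteqP; split => // w [h [h' _]].
rewrite ge0_muleDr// [leRHS]addeC; apply: leeD2l.
rewrite -integral_cst//; apply: ge0_le_integral => //.
- by move=> w _; rewrite lee_fin ltW.
- exact: mf'.
- by move=> w [_ /= aw]; rewrite lee_fin.
Qed.

(* The nonnegative reverse supermartingale case of Doob's maximal inequality. *)
Lemma reverse_maximal_finite m M : (m <= M)%N ->
  (forall n, (m <= n < M)%N ->
    \int[P]_(w in below n.+1 M) (f n w)%:E <=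
    \int[P]_(w in below n.+1 M) (f n.+1 w)%:E)%E ->
  (a%:E * P (~` below m M) <= \int[P]_w (f M w)%:E)%E.
Proof.
move=> mM H.
(* Descending induction from [M]: the hypothesis [H] replaces [f n] by [f n.+1], then [below_split]
   peels off the index [n.+1]. *)
have intH n : (m <= n <= M)%N ->
    (\int[P]_(w in below n.+1 M) (f n w)%:E + a%:E * P (~` below n.+1 M) <=
     \int[P]_w (f M w)%:E)%E.
  move=> /andP[mn nM]; have [k] := ubnP (M - n)%N.
  elim: k n mn nM => // k ih n mn nM kM.
  have [MnE|nM'] := eqVneq n M.
    rewrite MnE (_ : below _ _ = setT).
      by rewrite setCT measure0 mule0 adde0.
    apply/seteqP; split => // w _ j /andP[Mj jM].
    by have := leq_trans Mj jM; rewrite ltnn.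
  have nltM : (n < M)%N by rewrite ltn_neqAle nM'.
  apply: le_trans (ih n.+1 _ _ _) => //; last 2 first.
  - by rewrite (leq_trans mn).
  - by rewrite -ltnS (leq_trans _ kM)// ltnS ltn_sub2l.
  apply: le_trans (below_split nltM); apply: leeD2r.
  by apply: H; rewrite mn nltM.
have hm : (m <= m <= M)%N by rewrite leqnn.
apply: (le_trans _ (intH m hm)).
apply: le_trans (below_split mM); rewrite leeDr//.
by apply: integral_ge0 => w _; rewrite lee_fin.
Qed.

Lemma reverse_maximal m (K : \bar R) :
  (forall n M, (m <= n < M)%N ->
    \int[P]_(w in below n.+1 M) (f n w)%:E <=
    \int[P]_(w in below n.+1 M) (f n.+1 w)%:E)%E ->
  (forall M, \int[P]_w (f M w)%:E <= K)%E ->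
  (a%:E * P [set w | exists2 n, (m <= n)%N & (a <= f n w)%R] <= K)%E.
Proof.
move=> H fK.
have : P (~` below m (m + M)) @[M --> \oo] -->
    P (\bigcup_M (~` below m (m + M))).
  apply: nondecreasing_cvg_mu.
  - by move=> M; exact: measurableC (measurable_below _ _).
  - by apply: bigcup_measurable => M _; exact: measurableC (measurable_below _ _).
  - move=> M N MN; apply/subsetPset; apply: subsetC => w h n /andP[mn nM].
    by apply: h; rewrite mn (leq_trans nM)// leq_add2l.
rewrite (_ : \bigcup_M _ = [set w | exists2 n, (m <= n)%N & (a <= f n w)%R]).
  move=> /(cvgeZl (isT : a%:E \is a fin_num)) /= h.
  rewrite -(cvg_lim _ h)//; apply: lime_le; first by apply/cvg_ex; eexists; exact: h.
  apply: nearW => M; apply: le_trans (fK (m + M)%N).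
  by apply: reverse_maximal_finite; [exact: leq_addr|move=> n h'; exact: H].
apply/seteqP; split => w /=.
  move=> [M _ /existsNP[n /not_implyP[/andP[mn _] /negP]]].
  by rewrite -leNgt => ?; exists n.
move=> [n mn an]; exists (n - m)%N => // /(_ n).
by rewrite subnKC// mn leqnn => /(_ isT); rewrite ltNge an.
Qed.

End maximal.

Section measurability.
Variables (R : realType) (d : measure_display) (T : measurableType d).
Implicit Types f g : T -> R.

Lemma measurable_fun_natb (b : T -> bool) :
  measurable [set x | b x] -> measurable_fun setT (fun x => (b x)%:R : R).
Proof.
move=> mb; rewrite (_ : (fun x => _) = (\1_[set x | b x] : T -> R)).
  exact: measurable_indic.
by apply/funext => x; rewrite indicE mem_setE.
Qed.

Lemma measurable_set_ler f g : measurable_fun setT f -> measurable_fun setT g ->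
  measurable [set x | f x <= g x].
Proof.
move=> mf mg; rewrite -[X in measurable X]setTI.
rewrite (_ : [set x | _] = (fun x => f x <= g x) @^-1` [set true])//.
exact: measurable_fun_ler.
Qed.

Lemma measurable_set_ltr f g : measurable_fun setT f -> measurable_fun setT g ->
  measurable [set x | f x < g x].
Proof.
move=> mf mg; rewrite -[X in measurable X]setTI.
rewrite (_ : [set x | _] = (fun x => f x < g x) @^-1` [set true])//.
exact: measurable_fun_ltr.
Qed.

Lemma measurable_funV_ge0 f : (forall x, 0 <= f x) ->
  measurable_fun setT f -> measurable_fun setT (fun x => (f x)^-1).
Proof.
move=> f0 mf; rewrite (_ : (fun x => _) = (fun x => f x `^ (-1))).
  by apply: (measurableT_comp (measurable_powR (-1)) mf).
by apply/funext => x; rewrite powR_inv1.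
Qed.

End measurability.

Lemma sume_const (R : realType) (I : Type) (s : seq I) (c : \bar R) :
  (\sum_(i <- s) c = (size s)%:R%:E * c)%E.
Proof.
rewrite mule_natl big_const_seq count_predT.
by elim: (size s) => [//|[|m] /= ->]; rewrite ?adde0.
Qed.

Section maximal_latent.
Variables (R : realType) (d : measure_display) (Omega : measurableType d).
Variables (P : probability Omega R) (Y T : nat -> {RV P >-> R}).
Variables mu nu : set R -> \bar R.
Hypothesis YT : forall k, independent_pair P (Y k) (T k).
Hypothesis indep : mutually_independent P (fun k w => (Y k w, T k w) : R * R).
Hypothesis Ymu : forall k A, measurable A -> P (Y k @^-1` A) = mu A.
Hypothesis Tnu : forall k A, measurable A -> P (T k @^-1` A) = nu A.

Variables (g : R * R -> R) (r : R * R -> R * R -> bool).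
Hypothesis g0 : forall z, 0 <= g z.
Hypothesis gr : forall z, g z != 0 -> r z z.
Hypothesis mg : measurable_fun setT g.
Hypothesis mr : forall k l, measurable [set x : path_space R | r (x k) (x l)].

Lemma measurable_risk_average s :
  measurable_fun setT (risk_average g r s : path_space R -> R).
Proof.
apply: measurable_sum => k; apply: measurable_funM.
  exact: measurableT_comp (measurable_coord k).
apply: measurable_funV_ge0; first by move=> x; exact: sumr_ge0.
by apply: measurable_sum => l; apply: measurable_fun_natb; exact: mr.
Qed.

Let f n w := risk_average g r (iota 0 n) (latent Y T w).

Let mf n : measurable_fun setT (f n).
Proof.
exact: measurableT_comp (measurable_risk_average _) (measurable_latent Y T).
Qed.

Let f0 n w : 0 <= f n w. Proof. exact: risk_average_ge0. Qed.

(** The event involves only averages over at least [n.+1] indices, so it is symmetric in the first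
    [n.+1] pairs. By exchangeability each of the [n.+1] averages with one index left out has the
    integral of [f n] over it, and [leave_one_out] bounds their sum pointwise. *)
Lemma risk_average_step a n M : (n < M)%N ->
  (\int[P]_(w in below f a n.+1 M) (f n w)%:E <=
   \int[P]_(w in below f a n.+1 M) (f n.+1 w)%:E)%E.
Proof.
move=> nM.
pose B : set (path_space R) := [set x | forall k, (n.+1 <= k <= M)%N ->
  risk_average g r (iota 0 k) x < a].
have mB : measurable B.
  rewrite (_ : B = \bigcap_(k in [set k | (n.+1 <= k <= M)%N])
      [set x | risk_average g r (iota 0 k) x < a]); last first.
    by apply/seteqP; split => x h k; exact: h.
  apply: bigcap_measurableType => k _; apply: measurable_set_ltr => //.
  exact: measurable_risk_average.
pose h k (x : path_space R) := (risk_average g r (iota 0 k) x * \1_B x)%:E.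
have mh k : measurable_fun setT (h k).
  apply/measurable_EFinP; apply: measurable_funM; first exact: measurable_risk_average.
  exact: measurable_indic.
have h0 k x : (0 <= h k x)%E.
  by rewrite lee_fin mulr_ge0 ?risk_average_ge0.
have fh k : (\int[P]_(w in below f a n.+1 M) (f k w)%:E =
    \int[P]_w h k (latent Y T w))%E.
  rewrite integral_mkcond; apply: eq_integral => w _.
  rewrite patchE /h indicE (_ : (w \in _) = (latent Y T w \in B)).
    by case: ifP => _; rewrite ?mulr1 ?mulr0.
  by apply/idP/idP => /set_mem wB; apply/mem_set.
rewrite !fh.
rewrite -(@lee_pmul2l _ n.+1%:R%:E)// ?lte_fin ?ltr0n//.
rewrite (_ : n.+1%:R%:E * _ =
    \sum_(j <- iota 0 n.+1) \int[P]_w h n (latent Y T w \o swap j n))%E; last first.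
  rewrite big_seq (eq_bigr (fun=> \int[P]_w h n (latent Y T w)))%E.
    by rewrite -big_seq sume_const size_iota.
  move=> j; rewrite mem_iota/= add0n => jn.
  have sl N k : (n.+1 <= N)%N -> (k < N)%N -> (swap j n k < N)%N.
    by move=> nN; apply: swap_lt => //; exact: leq_trans jn nN.
  exact: (integral_latent_perm YT indep Ymu Tnu (swapK j n) (swapK j n) sl sl
    (mh n) (h0 n)).
rewrite -ge0_integralZl//; last exact: measurableT_comp (mh _) (measurable_latent Y T).
rewrite -ge0_integral_sum//; last first.
  by move=> j; exact: measurableT_comp (mh _) (measurable_latent_perm _ _ _ _).
apply: ge0_le_integral => //.
- by move=> w _; exact: sume_ge0.
- apply: emeasurable_sum => j.
  exact: measurableT_comp (mh _) (measurable_latent_perm _ _ _ _).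
- apply: measurable_funeM.
  exact: measurableT_comp (mh _) (measurable_latent Y T).
move=> w _; rewrite /h sumEFin -EFinM lee_fin.
set x := latent Y T w.
(* For [k > n] the transposition permutes [iota 0 k], which leaves the average unchanged. *)
have swapB j : (j <= n)%N -> (\1_B (x \o swap j n) : R) = \1_B x.
  move=> jn; rewrite !indicE; congr (_%:R); apply: congr1.
  apply/idP/idP => /set_mem xB; apply/mem_set => k nk.
    rewrite -(perm_risk_average g r x (perm_map_involutive (swapK j n) _)); last first.
      move=> l lk; have /andP[nk' _] := nk.
      by apply: swap_lt => //; exact: leq_ltn_trans jn nk'.
    by rewrite -risk_average_comp; exact: xB.
  rewrite risk_average_comp.
  rewrite (perm_risk_average g r x (perm_map_involutive (swapK j n) _)); last first.
    move=> l lk; have /andP[nk' _] := nk.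
    by apply: swap_lt => //; exact: leq_ltn_trans jn nk'.
  exact: xB.
rewrite mulrA big_seq (eq_bigr (fun j =>
  risk_average g r (rem j (iota 0 n.+1)) x * \1_B x)); last first.
  move=> j; rewrite mem_iota/= add0n ltnS => jn; rewrite swapB//.
  (* The transposition of [j] and [n] carries [iota 0 n] to [iota 0 n.+1] without [j], up to
     order. *)
  congr (_ * _); rewrite risk_average_comp; apply: perm_risk_average.
  rewrite -(perm_cons j).
  have jiota : j \in iota 0 n.+1 by rewrite mem_iota.
  rewrite -(permPr (perm_to_rem jiota)).
  have /permPr <- := perm_map_involutive (swapK j n) (M := n.+1)
    (fun k => @swap_lt j n n.+1 k jn (ltnSn n)).
  rewrite perm_sym -addn1 iotaD/= map_cat/= perm_catC/= add0n.
  suff -> : swap j n n = j by [].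
  by rewrite /swap eqxx; case: eqP.
rewrite -big_seq -mulr_suml ler_wpM2r//.
by apply: le_trans (leave_one_out g0 gr _ (iota_uniq _ _)) _; rewrite size_iota.
Qed.

Lemma maximal_risk_average (K : \bar R) a : 0 < a ->
  (forall M, \int[P]_w (f M w)%:E <= K)%E ->
  (a%:E * P [set w | exists n, (a <= f n w)%R] <= K)%E.
Proof.
move=> a0 fK; rewrite (_ : [set w | _] =
  [set w | exists2 n, (0 <= n)%N & (a <= f n w)%R]).
  apply: reverse_maximal => // n M /andP[_ nM]; exact: risk_average_step.
by apply/seteqP; split => w [n]; exists n.
Qed.

Lemma measurable_maximal a : measurable [set w | exists n, (a <= f n w)%R].
Proof.
rewrite (_ : [set w | _] = \bigcup_n [set w | a <= f n w]).
  by apply: bigcup_measurable => n _; apply: measurable_set_ler.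
by apply/seteqP; split => w [n]; [exists n|move=> _; exists n].
Qed.

End maximal_latent.

Lemma ge0_integral_mrestr (R : realType) (d : measure_display)
    (T : measurableType d) (m : {measure set T -> \bar R}) (D : set T)
    (mD : measurable D) (f : T -> \bar R) :
  measurable_fun setT f -> (forall x, 0 <= f x)%E ->
  (\int[mrestr m mD]_x f x = \int[m]_(x in D) f x)%E.
Proof.
move=> mf f0; rewrite -(setUv D) ge0_integral_setU//=; last 3 first.
- exact: measurableC.
- exact: measurable_funTS.
- exact/disj_set2P/setICr.
rewrite [X in (_ + X)%E]null_set_integral ?adde0//; last 3 first.
- exact: measurableC.
- exact: measurable_funTS.
- by rewrite /= /mrestr setICl measure0.
apply: eq_measure_integral => A mA AD.
by rewrite /= /mrestr setIidl.
Qed.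

Section stieltjes_rays.
Variables (R : realType) (F : cumulativeBounded (0 : R) (1 : R)).
Let mu := lebesgue_stieltjes_measure F.

Lemma lebesgue_stieltjes_Nyc a : mu `]-oo, a] = (F a)%:E.
Proof.
have := cdf_lebesgue_stieltjes_id F a.
by rewrite /cdf /distribution /pushforward /= preimage_id.
Qed.

Lemma lebesgue_stieltjes_oy a : mu `]a, +oo[ = (1 - F a)%:E.
Proof.
have mI : measurable (`]-oo, a]%classic : set (measurableTypeR R)).
  exact: measurable_itv.
have := probability_setC (lebesgue_stieltjes_measure F) mI.
by rewrite setCitvl => muE; rewrite [LHS]muE EFinB -lebesgue_stieltjes_Nyc//.
Qed.

End stieltjes_rays.

(** * Bounds on the expectations of risk averages *)

Section expectation.
Variables (R : realType) (d : measure_display) (Omega : measurableType d).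
Variables (P : probability Omega R) (Y T : nat -> {RV P >-> R}).
Variable F : cumulativeBounded (0 : R) (1 : R).
Variable nu : set R -> \bar R.
Let mu := lebesgue_stieltjes_measure F.
Hypothesis YT : forall k, independent_pair P (Y k) (T k).
Hypothesis indep : mutually_independent P (fun k w => (Y k w, T k w) : R * R).
Hypothesis Ymu : forall k A, measurable A -> P (Y k @^-1` A) = mu A.
Hypothesis Tnu : forall k A, measurable A -> P (T k @^-1` A) = nu A.

Lemma integral_law k (phi : R -> \bar R) :
  measurable_fun [set: measurableTypeR R] phi -> (forall y, 0 <= phi y)%E ->
  (\int[P]_w phi (Y k w) = \int[mu]_y phi y)%E.
Proof.
move=> mphi phi0.
have mY : measurable_fun [set: Omega] (Y k : Omega -> measurableTypeR R).
  by move=> _ A mA; exact: (measurable_funPT (Y k) measurableT).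
rewrite -[LHS](ge0_integral_pushforward mY P measurableT mphi)//.
by apply: eq_measure_integral => A mA _; exact: Ymu.
Qed.

(** As [h] sees only the first [N] pairs, it may be evaluated at the sequence [X] from which pair
    [N] is removed by [bump]. Independence of [X] and [Y N] is then checked on rectangles: [P]
    restricted to [Y N] in [D] against [P] scaled by [mu D]. *)
Lemma integral_latent_indep N (D : set R) (h : path_space R -> \bar R) :
  measurable D ->
  measurable_fun setT h -> (forall x, 0 <= h x)%E ->
  (forall x y, (forall k, (k < N)%N -> x k = y k) -> h x = h y) ->
  (\int[P]_(w in Y N @^-1` D) h (latent Y T w) =
   mu D * \int[P]_w h (latent Y T w))%E.
Proof.
move=> mD mh h0 hN.
have mYD : measurable (Y N @^-1` D) by exact: measurable_funPTI.
have muD : mu D \is a fin_num by rewrite -(@Ymu N)// fin_num_measure.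
have mhl : measurable_fun setT (h \o latent Y T).
  exact: measurableT_comp mh (measurable_latent Y T).
rewrite -(ge0_integral_mrestr P mYD mhl (fun w => h0 _)).
pose c := fine (mu D).
have c0 : 0 <= c by rewrite fine_ge0.
rewrite -[X in (X * _)%E]fineK// -/c.
have := ge0_integral_mscale P measurableT (NngNum c0) mhl (fun w _ => h0 _).
move=> /= <-.
pose X w : path_space R := latent Y T w \o bump N.
rewrite (eq_integral (fun w => h (X w))); last first.
  move=> w _; apply: hN => k kN; rewrite /X/=.
  by rewrite /bump leqNgt kN.
apply: eq_integral_path => //.
- by rewrite /= /mrestr setTI (le_lt_trans (probability_le1 _ _))// ltry.
- exact: measurable_latent_perm.
- exact: measurable_latent.
move=> M B C mB mC; rewrite /= /mrestr /mscale/=.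
rewrite (latent_rectangle YT indep Ymu Tnu)// fineK//.
pose A k := if k == N then D `*` setT else B (unbump N k) `*` C (unbump N k).
rewrite (_ : _ `&` _ = \bigcap_(i in [set` N :: map (bump N) (iota 0 M)])
    ((fun w => (Y i w, T i w) : R * R) @^-1` A i)).
  rewrite indep; last 2 first.
  - rewrite /= map_inj_uniq ?iota_uniq ?andbT; last exact: (can_inj (bumpK N)).
    by apply/mapP => -[k _] /eqP; rewrite (negbTE (neq_bump N k)).
  - move=> k; rewrite /A; case: ifP => _; first exact: measurableX.
    exact: measurableX.
  rewrite big_cons /A eqxx; congr (_ * _)%E.
    rewrite -(@Ymu N)//; congr (P _).
    by apply/seteqP; split => w //= [].
  rewrite big_map; apply: eq_bigr => k _.
  rewrite eq_sym (negbTE (neq_bump N k)) bumpK.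
  by rewrite -(@Ymu (bump N k))// -(@Tnu (bump N k))// -YT.
apply/seteqP; split => w /=.
  move=> [h1 h2] k /=; rewrite inE => /orP[/eqP->|/mapP[j]]; first by rewrite /A eqxx.
  rewrite mem_iota/= add0n => jM ->.
  by rewrite /A eq_sym (negbTE (neq_bump N j)) bumpK; exact: h1.
move=> wA; split => [k kM|]; last first.
  by have := wA N; rewrite /= /A mem_head eqxx => /(_ isT)[].
have := wA (bump N k); rewrite /= inE map_f ?orbT ?mem_iota//= => /(_ isT).
by rewrite /A eq_sym (negbTE (neq_bump N k)) bumpK.
Qed.

(** An unobserved pair has [z'.1 < z'.2] and is never at risk, so counting among the latent pairs is
    counting in the sample. *)
Definition at_risk (z z' : R * R) : bool := z'.2 <= z.1 <= z'.1.

Definition observed (phi : R -> R) (z : R * R) : R := (z.2 <= z.1)%R%:R * phi z.1.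

Lemma observed_at_risk phi z : observed phi z != 0 -> at_risk z z.
Proof.
by rewrite /observed /at_risk lexx andbT; case: (_ <= _); rewrite ?mul0r ?eqxx.
Qed.

Lemma measurable_fst_coord k :
  measurable_fun setT (fun x : path_space R => (x k).1).
Proof. exact: measurableT_comp (measurable_fst) (measurable_coord k). Qed.

Lemma measurable_snd_coord k :
  measurable_fun setT (fun x : path_space R => (x k).2).
Proof. exact: measurableT_comp (measurable_snd) (measurable_coord k). Qed.

Lemma measurable_at_risk k l :
  measurable [set x : path_space R | at_risk (x k) (x l)].
Proof.
rewrite (_ : [set x | _] = [set x : path_space R | (x l).2 <= (x k).1] `&`
    [set x : path_space R | (x k).1 <= (x l).1]).
  apply: measurableI; apply: measurable_set_ler;
    by [exact: measurable_fst_coord|exact: measurable_snd_coord].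
by apply/seteqP; split => x /= /andP.
Qed.

Variable phi : R -> R.
Hypothesis mphi : measurable_fun [set: R] phi.
Hypothesis phi0 : forall y, 0 <= phi y.

Lemma measurable_observed : measurable_fun setT (observed phi).
Proof.
apply: measurable_funM; last exact: measurableT_comp mphi measurable_fst.
by apply: measurable_fun_natb; apply: measurable_set_ler;
  [exact: measurable_snd|exact: measurable_fst].
Qed.

Lemma observed_ge0 z : 0 <= observed phi z.
Proof. by rewrite mulr_ge0. Qed.

(* Exchanging [Y k] with the [Y] of the independent extra pair [N] turns the
   [k]-th term into a share of [phi (Y N)], and the shares add up to at most 1. *)
Lemma risk_average_expectation (a : R) N :
  (forall y, a < y -> phi y = 0) ->
  ((1 - F a)%:E *
     \int[P]_w (risk_average (observed phi) at_risk (iota 0 N) (latent Y T w))%:E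
   <= \int[mu]_y (phi y)%:E)%E.
Proof.
move=> phia; pose s := iota 0 N.
pose share k (x : path_space R) := phi (x N).1 *
  (at_risk (x N) (x k))%:R / \sum_(l <- s) (at_risk (x N) (x l))%:R.
have mshare k : measurable_fun setT (EFin \o share k).
  apply/measurable_EFinP; apply: measurable_funM; first apply: measurable_funM.
  - exact: measurableT_comp mphi (measurable_fst_coord N).
  - by apply: measurable_fun_natb; exact: measurable_at_risk.
  apply: measurable_funV_ge0; first by move=> x; exact: sumr_ge0.
  apply: measurable_sum => l.
  by apply: measurable_fun_natb; exact: measurable_at_risk.
have share0 k x : (0 <= (EFin \o share k) x)%E.
  by rewrite lee_fin divr_ge0 ?mulr_ge0 ?sumr_ge0.
have sum_share x : \sum_(k <- s) share k x <= phi (x N).1.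
  rewrite /share -mulr_suml -mulr_sumr -mulrA ler_piMr//.
  set S := \sum_(_ <- _) _; have [->|S0] := eqVneq S 0; first by rewrite mul0r.
  by rewrite divff.
have mra : measurable_fun setT
    (EFin \o (risk_average (observed phi) at_risk s : path_space R -> R)).
  apply/measurable_EFinP; apply: measurable_risk_average => //.
  - exact: measurable_observed.
  - exact: measurable_at_risk.
have ra0 x : (0 <= (EFin \o (risk_average (observed phi) at_risk s)) x)%E.
  by rewrite lee_fin risk_average_ge0// => z; exact: observed_ge0.
rewrite -lebesgue_stieltjes_oy.
(* The factor [1 - F a] is the probability that the extra [Y N] exceeds [a], independently of the
   first [N] pairs. *)
have := @integral_latent_indep N `]a, +oo[%classic _ (measurable_itv _) mra ra0.
move=> /= <-; last first.
  move=> x y xy; congr (_%:E); rewrite /risk_average big_seq [RHS]big_seq.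
  have xy' k : k \in s -> x k = y k by rewrite mem_iota => /xy.
  apply: eq_bigr => k ks; rewrite xy'//; congr (_ / _).
  by rewrite big_seq [RHS]big_seq; apply: eq_bigr => l ls; rewrite xy'.
pose swapped k w : path_space R := fun i => (Y (swap k N i) w, T i w).
have swap_share k : (\int[P]_w (share k (swapped k w))%:E =
    \int[P]_w (share k (latent Y T w))%:E)%E.
  apply: (@integral_latent_perm _ _ _ P Y T mu nu YT indep Ymu Tnu
      (swap k N) id (maxn k.+1 N.+1) (EFin \o share k)) => //.
  - exact: swapK.
  - by move=> M i; rewrite geq_max => /andP[kM NM]; exact: swap_lt.
have mswapped k : measurable_fun setT (swapped k).
  exact: (measurable_latent_perm Y T (swap k N) id).
apply: (@le_trans _ _ (\int[P]_w \sum_(k <- s) (share k (swapped k w))%:E)%E); last first.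
  rewrite ge0_integral_sum//; last 2 first.
  - by move=> k; exact: measurableT_comp (mshare k) (mswapped k).
  - by move=> k w _; exact: share0.
  under eq_bigr do rewrite swap_share.
  rewrite -ge0_integral_sum//; last 2 first.
  - by move=> k; exact: measurableT_comp (mshare k) (measurable_latent Y T).
  - by move=> k w _; exact: share0.
  rewrite -(integral_law N (phi := EFin \o phi)); last 2 first.
  - by apply/measurable_EFinP.
  - by move=> y; rewrite lee_fin.
  apply: ge0_le_integral => //.
  - by move=> w _; apply: sume_ge0 => k _; exact: share0.
  - apply: emeasurable_sum => k.
    exact: measurableT_comp (mshare k) (measurable_latent Y T).
  - apply/measurable_EFinP; exact: measurableT_comp mphi _.
  - by move=> w _; rewrite sumEFin lee_fin; exact: sum_share.
rewrite integral_mkcond; apply: ge0_le_integral => //.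
- by move=> w _; rewrite patchE; case: ifP => // _; exact: ra0.
- apply/(measurable_restrictT _ _).1; first exact: measurable_funPTI.
  apply: measurable_funTS.
  exact: measurableT_comp mra (measurable_latent Y T).
- apply: emeasurable_sum => k; exact: measurableT_comp (mshare k) (mswapped k).
move=> w _; rewrite patchE; case: ifPn => [/set_mem|_]; last first.
  by apply: sume_ge0 => k _; exact: share0.
rewrite /= in_itv/= andbT => aYN.
rewrite sumEFin lee_fin /risk_average big_seq [leRHS]big_seq.
apply: ler_sum => k; rewrite mem_iota/= add0n => kN.
have swapN : swap k N N = k by rewrite /swap gtn_eqF// eqxx.
have swapk : swap k N k = N by rewrite /swap eqxx.
rewrite /share /swapped swapN swapk /observed/=.
(* In the remaining case [Y k <= a < Y N], so an observed pair [k] is still at risk at [Y k] after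
   receiving [Y N]: the exchange does not change the risk count. *)
have [Yka|aYk] := leP (Y k w) a; last by rewrite phia// mulr0 !mul0r.
rewrite [X in X / _]mulrC -!mulrA ler_wpM2l// /at_risk/=.
rewrite (le_trans Yka (ltW aYN)) andbT.
have [TYk|] := leP (T k w) (Y k w); last by rewrite !mul0r.
rewrite !mul1r le_eqVlt; apply/orP; left; apply/eqP; congr (_^-1).
rewrite big_seq [RHS]big_seq; apply: eq_bigr => l; rewrite mem_iota/= add0n => lN.
have [->|lk] := eqVneq l k; first by rewrite swapk TYk lexx (le_trans Yka (ltW aYN)).
by rewrite /swap (negbTE lk) ltn_eqF.
Qed.

Lemma mean_expectation M :
  (\int[P]_w (risk_average (fun z => phi z.1) (fun _ _ => true) (iota 0 M)
    (latent Y T w))%:E <= \int[mu]_y (phi y)%:E)%E.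
Proof.
have I0 : (0 <= \int[mu]_y (phi y)%:E)%E.
  by apply: integral_ge0 => y _; rewrite lee_fin.
under eq_integral do rewrite -sumEFin.
rewrite ge0_integral_sum//; last 2 first.
- move=> k; apply/measurable_EFinP; apply: measurable_funM => //.
  exact: measurableT_comp mphi _.
- by move=> k w _; rewrite lee_fin divr_ge0// sumr_ge0.
rewrite (eq_bigr (fun=> M%:R^-1%:E * \int[mu]_y (phi y)%:E)%E); last first.
  move=> k _; rewrite -(integral_law k (phi := EFin \o phi)); last 2 first.
  - by apply/measurable_EFinP.
  - by move=> y; rewrite lee_fin.
  rewrite -ge0_integralZl//; last 2 first.
  - apply/measurable_EFinP; exact: measurableT_comp mphi _.
  - by move=> w _; rewrite lee_fin.
  apply: eq_integral => w _; rewrite big_const_seq count_predT size_iota iter_addr_0.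
  by rewrite -EFinM mulrC.
rewrite sume_const size_iota muleA -EFinM.
have [->|M0] := eqVneq M 0%N; first by rewrite mul0r mul0e.
by rewrite divff ?pnatr_eq0// mul1e.
Qed.

End expectation.

(** * The sample as a function of the latent pairs *)

Section observed_among.
Variables (R : realType) (d : measure_display) (Omega : measurableType d).
Variables (P : probability Omega R) (Y T : nat -> {RV P >-> R}).

Let sample N w := observed_among Y T N w.

Lemma sum_observed (f : R * R -> R) N w :
  \sum_(p <- sample N w) f p =
  \sum_(k <- iota 0 N | T k w <= Y k w) f (Y k w, T k w).
Proof. by rewrite /sample /observed_among big_map big_filter. Qed.

Lemma risk_observed N w v :
  risk (sample N w) v = \sum_(k <- iota 0 N) (T k w <= v <= Y k w)%R%:R.
Proof.
rewrite /risk sum_observed big_mkcond/=; apply: eq_bigr => k _.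
by case: ifPn => //; rewrite -ltNge => YkT; case: andP => // -[Tv /(le_trans Tv)];
  rewrite leNgt YkT.
Qed.

Lemma uniq_observed N w : (forall k l, k <> l -> Y k w <> Y l w) ->
  uniq (map fst (sample N w)).
Proof.
move=> Yw; rewrite /sample /observed_among -map_comp map_inj_uniq/=.
  by rewrite filter_uniq// iota_uniq.
by move=> k l /= Ykl; apply: contrapT => /Yw.
Qed.

Lemma observed_truncated N w : {in sample N w, forall p, p.2 <= p.1}.
Proof.
by move=> p /mapP[k]; rewrite mem_filter => /andP[TY _] ->.
Qed.

(** Makes the errors at the bracket ends measurable, so that they can bound a measurable cover. *)
Lemma measurable_estimate N (phi : R -> R) : measurable_fun [set: R] phi ->
  measurable_fun [set: Omega] (fun w => estimate (sample N w) phi).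
Proof.
move=> mphi.
have mY k : measurable_fun [set: Omega] (Y k) := measurable_funPT (Y k).
have mT k : measurable_fun [set: Omega] (T k) := measurable_funPT (T k).
have mTY k : measurable_fun setT (fun w => (T k w <= Y k w)%R%:R : R).
  by apply: measurable_fun_natb; exact: measurable_set_ler.
have mrisk k : measurable_fun setT (fun w => risk (sample N w) (Y k w)).
  under eq_fun do rewrite risk_observed; apply: measurable_sum => l.
  apply: (@measurable_fun_natb _ _ _ (fun w => T l w <= Y k w <= Y l w)%R).
  rewrite (_ : [set _ | _] = [set w | (T l w <= Y k w)%R] `&` [set w | (Y k w <= Y l w)%R]).
    by apply: measurableI; exact: measurable_set_ler.
  by apply/seteqP; split => w /= /andP.
have mriskV k : measurable_fun setT (fun w => (risk (sample N w) (Y k w))^-1).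
  by apply: measurable_funV_ge0 => // w; exact: risk_ge0.
have msurv k : measurable_fun setT (fun w => surv (sample N w) (Y k w)).
  have -> : (fun w => surv (sample N w) (Y k w)) = fun w =>
      \prod_(l <- iota 0 N) (1 - (T l w <= Y l w)%R%:R * (Y l w < Y k w)%R%:R *
        (1 - (risk (sample N w) (Y l w) - 1) / risk (sample N w) (Y l w))).
    apply/funext => w; rewrite /surv {1}/sample /observed_among big_map.
    rewrite big_filter_cond big_mkcond/=; apply: eq_bigr => l _.
    by case: (T l w <= Y l w); case: (Y l w < Y k w) => /=; lra.
  apply: measurable_prod => l _; apply: measurable_funB => //.
  apply: measurable_funM; first apply: measurable_funM => //.
    by apply: measurable_fun_natb; exact: measurable_set_ltr.
  apply: measurable_funB => //; apply: measurable_funM => //.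
  exact: measurable_funB.
have -> : (fun w => estimate (sample N w) phi) = fun w => \sum_(k <- iota 0 N)
    (T k w <= Y k w)%R%:R * (surv (sample N w) (Y k w) / risk (sample N w) (Y k w) *
      phi (Y k w)).
  apply/funext => w; rewrite /estimate sum_observed big_mkcond/=.
  by apply: eq_bigr => k _; rewrite /jump/=; case: ifP; rewrite ?mul1r ?mul0r.
apply: measurable_sum => k; apply: measurable_funM => //; apply: measurable_funM.
  exact: measurable_funM.
exact: measurableT_comp.
Qed.

Lemma size_observedS N w :
  size (sample N.+1 w) = (size (sample N w) + (T N w <= Y N w)%R)%N.
Proof.
rewrite /sample /observed_among !size_map -[N.+1]addn1 iotaD filter_cat size_cat.
by congr addn; rewrite /= add0n; case: ifP.
Qed.

Lemma size_observed N w : (size (sample N w) <= N)%N.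
Proof.
by rewrite /sample /observed_among size_map size_filter -[leqRHS](size_iota 0) count_size.
Qed.

(** Each latent pair adds at most one observation, so an unbounded sample size takes every value
    [n]; and [n] observations need at least [n] latent pairs. *)
Lemma truncated_sampleE n w : (forall m, exists N, (m <= size (sample N w))%N) ->
  exists2 N, (n <= N)%N & truncated_sample Y T n w = sample N w.
Proof.
move=> h; have exN : exists N, size (sample N w) = n.
  case: (ex_minnP (h n)) => -[|N] nN minN.
    by exists 0%N; apply/eqP; rewrite eqn_leq nN andbT.
  exists N.+1; apply/eqP; rewrite eqn_leq nN andbT size_observedS.
  have : (size (sample N w) < n)%N.
    by rewrite ltnNge; apply/negP => /minN; rewrite ltnn.
  by case: (_ <= _)%R => /=; rewrite ?addn1// addn0 => /ltnW.
set M := xget 0%N [set N | size (sample N w) = n].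
have sM : size (sample M w) = n by exact: (xgetPex 0%N exN).
by exists M => //; rewrite -[leqLHS]sM size_observed.
Qed.

End observed_among.

(** * Almost sure convergence *)

Section almost_sure.
Variables (R : realType) (d : measure_display) (Omega : measurableType d).
Variable P : probability Omega R.

Lemma ae_forall_gt0 (Q : R -> Omega -> Prop) :
  (forall a b w, a <= b -> Q a w -> Q b w) ->
  (forall a, 0 < a -> {ae P, forall w, Q a w}) ->
  {ae P, forall w, forall a, 0 < a -> Q a w}.
Proof.
move=> Qle Qae.
have : {ae P, forall w, forall i : nat, Q i.+1%:R^-1 w}.
  by apply/ae_foralln => i; apply: Qae; rewrite invr_gt0.
apply: filterS => w Qw a a0.
have [i _ /(_ i (leqnn i)) ia] := near_infty_natSinv_lt (PosNum a0).
exact: Qle (ltW ia) (Qw i).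
Qed.

(** [P (E j a) <= K j / a] for every [j] makes the intersection of the [E j a] null. One good [j] is
    wanted, so it is enough that [K] comes arbitrarily close to 0. *)
Lemma ae_exists_small (E : nat -> R -> set Omega) (K : nat -> R) :
  (forall j a, measurable (E j a)) ->
  (forall j a b, a <= b -> E j b `<=` E j a) ->
  (forall j (a : R), 0 < a -> (a%:E * P (E j a) <= (K j)%:E)%E) ->
  (forall e : R, 0 < e -> exists j, K j <= e) ->
  {ae P, forall w, forall a, 0 < a -> exists j, ~ E j a w}.
Proof.
move=> mE Ele EK K0; apply: ae_forall_gt0 => [a b w ab [j Ea]|a a0].
  by exists j => Eb; exact: Ea (Ele _ _ _ ab _ Eb).
exists (\bigcap_j E j a); split.
- by apply: bigcapT_measurable => j; exact: mE.
- apply/eqP; rewrite eq_le measure_ge0 andbT.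
  apply/lee_addgt0Pr => e e0; rewrite add0e.
  have [j Kj] := K0 (a * e) (mulr_gt0 a0 e0).
  apply: (@le_trans _ _ (P (E j a))).
    apply: le_measure; rewrite ?inE; [|exact: mE|by move=> w; apply].
    by apply: bigcapT_measurable => i; exact: mE.
  rewrite -(@lee_pmul2l _ a%:E)// ?lte_fin//.
  by rewrite (le_trans (EK j a a0))// -EFinM lee_fin.
by move=> w /= /forallNP h j _ /=; apply: contrapT; exact: h.
Qed.

(** The series of the [f m] has finite expectation, so it converges almost surely and its terms tend
    to 0. *)
Lemma ae_cvg0_summable (f : nat -> Omega -> R) (c : nat -> R) (K : R) :
  (forall m, measurable_fun setT (f m)) -> (forall m w, 0 <= f m w) ->
  (forall m, \int[P]_w (f m w)%:E <= (c m)%:E)%E ->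
  (forall n, \sum_(0 <= m < n) c m <= K) ->
  {ae P, forall w, f m w @[m --> \oo] --> 0}.
Proof.
move=> mf f0 fc cK.
have mf' m : measurable_fun setT (EFin \o f m) by exact/measurable_EFinP.
pose S w := (\sum_(m <oo) (f m w)%:E)%E.
have S0 w : (0 <= S w)%E by apply: nneseries_ge0 => m _ _; rewrite lee_fin.
have mS : measurable_fun setT S.
  by apply: ge0_emeasurable_sum => [m w _ _|m _]; [rewrite lee_fin|exact: mf'].
have iS : P.-integrable setT S.
  apply/integrableP; split => //.
  rewrite (eq_integral S); last by move=> w _; rewrite gee0_abs.
  rewrite /S integral_nneseries//; last by move=> m w _; rewrite lee_fin.
  apply: (@le_lt_trans _ _ K%:E); last exact: ltry.
  apply: lime_le.
    apply: is_cvg_nneseries => m _ _.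
    by apply: integral_ge0 => w _; rewrite lee_fin.
  apply: nearW => n; apply: (@le_trans _ _ (\sum_(0 <= m < n) (c m)%:E)%E).
    by apply: lee_sum => m _; exact: fc.
  by rewrite sumEFin lee_fin.
have := integrable_ae measurableT iS; apply: filterS => w /(_ I) Sw.
apply: cvg_series_cvg_0; apply: nondecreasing_is_cvgn.
  by apply: (@nondecreasing_series R (f ^~ w) xpredT 0%N) => m _ _.
exists (fine (S w)) => _ [n _ <-] /=.
rewrite -lee_fin fineK// /series/= -sumEFin.
by apply: nneseries_lim_ge => m _ _; rewrite lee_fin.
Qed.

Section events.
Variables (D : nat -> set Omega) (p : R).
Hypothesis mD : forall k, measurable (D k).
Hypothesis PD : forall k, P (D k) = p%:E.
Hypothesis PDI : forall k l, k != l -> P (D k `&` D l) = (p * p)%:E.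

Let count N w : R := \sum_(k <- iota 0 N) \1_(D k) w.

Let mcount N : measurable_fun setT (count N).
Proof. by apply: measurable_sum => k; exact: measurable_indic. Qed.

Let p0 : 0 <= p.
Proof. by rewrite -lee_fin -(PD 0) measure_ge0. Qed.

Let p1 : p <= 1.
Proof. by rewrite -lee_fin -(PD 0) probability_le1. Qed.

Let count0 N w : 0 <= count N w.
Proof. by apply: sumr_ge0 => k _; rewrite indicE. Qed.

Let integral_count N : (\int[P]_w (count N w)%:E = (N%:R * p)%:E)%E.
Proof.
under eq_integral do rewrite -sumEFin.
rewrite ge0_integral_sum//; last first.
  by move=> k; apply/measurable_EFinP; exact: measurable_indic.
rewrite (eq_bigr (fun=> p%:E)); last first.
  by move=> k _; rewrite integral_indic// setIT; exact: PD.
by rewrite sume_const size_iota EFinM.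
Qed.

Let integral_count2 N :
  (\int[P]_w (count N w ^+ 2)%:E = (N%:R * p + N%:R * (N%:R - 1) * (p * p))%:E)%E.
Proof.
have E w : count N w ^+ 2 = \sum_(k <- iota 0 N) \sum_(l <- iota 0 N) \1_(D k `&` D l) w.
  rewrite expr2 /count mulr_suml; apply: eq_bigr => k _.
  by rewrite mulr_sumr; apply: eq_bigr => l _; rewrite indicI.
under eq_integral do rewrite E -sumEFin.
have mkl k l : measurable_fun setT (EFin \o (\1_(D k `&` D l) : Omega -> R)).
  by apply/measurable_EFinP; apply: measurable_indic; exact: measurableI.
have kl0 k l w : (0 <= (\1_(D k `&` D l) w : R)%:E)%E by rewrite lee_fin indicE.
rewrite ge0_integral_sum//; last 2 first.
- by move=> k; apply/measurable_EFinP; apply: measurable_sum => l;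
    apply/measurable_EFinP; exact: mkl.
- by move=> k w _; rewrite lee_fin sumr_ge0// => l _; rewrite -lee_fin.
rewrite big_seq (eq_bigr (fun=> (p + (N%:R - 1) * (p * p))%:E)); last first.
  move=> k kN; under eq_integral do rewrite -sumEFin.
  rewrite ge0_integral_sum//; last by move=> l; exact: mkl.
  rewrite (eq_bigr (fun l => P (D k `&` D l))); last first.
    by move=> l _; rewrite integral_indic ?setIT//; exact: measurableI.
  rewrite (bigD1_seq k kN (iota_uniq _ _))/= setIid PD.
  rewrite (eq_bigr (fun=> (p * p)%:E)); last by move=> l lk; rewrite PDI// eq_sym.
  rewrite sumEFin -EFinD; congr ((_ + _)%:E).
  have sumN : \sum_(l <- iota 0 N) (p * p) = N%:R * (p * p).
    by rewrite big_const_seq count_predT size_iota iter_addr_0 mulr_natl.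
  rewrite mulrBl mul1r -sumN (bigD1_seq k kN (iota_uniq _ _))/= addrC addrK.
  by [].
rewrite -big_seq sume_const size_iota -EFinM; congr (_%:E).
by rewrite mulrDr mulrA.
Qed.

Let second_moment N :
  (\int[P]_w ((count N w - N%:R * p) ^+ 2)%:E <= N%:R%:E)%E.
Proof.
have I0 : (0 <= \int[P]_w ((count N w - N%:R * p) ^+ 2)%:E)%E.
  by apply: integral_ge0 => w _; rewrite lee_fin sqr_ge0.
have mS : measurable_fun setT (fun w => (count N w - N%:R * p) ^+ 2).
  by apply: measurable_funX; apply: measurable_funB.
have Np0 : 0 <= 2 * (N%:R * p) by rewrite !mulr_ge0.
(* The square is expanded with the cross term on the left: all integrands are then nonnegative, and
   finiteness can be read off before subtracting. *)
have : (\int[P]_w ((count N w - N%:R * p) ^+ 2)%:E +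
    (2 * (N%:R * p))%:E * \int[P]_w (count N w)%:E =
    \int[P]_w (count N w ^+ 2)%:E + ((N%:R * p) ^+ 2)%:E)%E.
  rewrite -ge0_integralZl_EFin//; last 2 first.
  - by move=> w _; rewrite lee_fin.
  - exact/measurable_EFinP.
  rewrite -ge0_integralD//; last 4 first.
  - by move=> w _; rewrite lee_fin sqr_ge0.
  - exact/measurable_EFinP.
  - by move=> w _; rewrite -EFinM lee_fin mulr_ge0.
  - by apply: measurable_funeM; exact/measurable_EFinP.
  rewrite -[X in (_ + X)%E]mule1 -(probability_setT P) -integral_cst//.
  rewrite -ge0_integralD//; last 3 first.
  - by move=> w _; rewrite lee_fin sqr_ge0.
  - by apply/measurable_EFinP; exact: measurable_funX.
  - by move=> w _; rewrite lee_fin sqr_ge0.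
  by apply: eq_integral => w _; rewrite -EFinM -!EFinD; congr (_%:E); rewrite !expr2; lra.
rewrite integral_count integral_count2 -!EFinD -EFinM => H.
have {H} -> : (\int[P]_w ((count N w - N%:R * p) ^+ 2)%:E = (N%:R * (p - p * p))%:E)%E.
  have fin : (\int[P]_w ((count N w - N%:R * p) ^+ 2)%:E)%E \is a fin_num.
    rewrite ge0_fin_numE//; apply: le_lt_trans (ltry (N%:R * p +
      N%:R * (N%:R - 1) * (p * p) + (N%:R * p) ^+ 2)).
    by rewrite -H leeDl// lee_fin mulr_ge0// mulr_ge0.
  move: H; rewrite -(fineK fin) -EFinD => -[H]; congr (_%:E); rewrite expr2 in H; lra.
rewrite lee_fin ler_piMr//.
by rewrite (le_trans _ p1)// gerBl mulr_ge0.
Qed.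

Let sum_inv_sqr n : \sum_(0 <= m < n) (m.+1%:R ^+ 2)^-1 <= 2 :> R.
Proof.
(* The sharper bound survives the induction, since [1 / a^2 <= 2 / (a * (a + 1))] for [a >= 1]. *)
suff : \sum_(0 <= m < n) (m.+1%:R ^+ 2)^-1 <= 2 - 2 / n.+1%:R :> R.
  by move=> /le_trans; apply; rewrite gerBl divr_ge0.
elim: n => [|n ih]; first by rewrite big_geq// divr1 subrr.
rewrite big_nat_recr//= (le_trans (lerD ih (lexx _)))//.
have a0 : 0 < n.+1%:R :> R by rewrite ltr0n.
have n1 : 1 <= n.+1%:R :> R by rewrite ler1n.
rewrite -[n.+2%:R]natr1; set a := n.+1%:R in a0 n1 *.
have a1 : 0 < a + 1 by lra.
have ia : a * a^-1 = 1 by rewrite divff// lt0r_neq0.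
have ja : (a + 1) * (a + 1)^-1 = 1 by rewrite divff// lt0r_neq0.
have i0 : 0 < a^-1 by rewrite invr_gt0.
have j0 : 0 < (a + 1)^-1 by rewrite invr_gt0.
have i1 : a^-1 <= 1 by rewrite invf_le1.
rewrite -exprVn expr2; set u := a^-1 in ia i0 i1 *; set v := (a + 1)^-1 in ja j0 *.
have uv : u - v = u * v.
  have : u * ((a + 1) * v) = u by rewrite ja mulr1.
  have : (a * u) * v = v by rewrite ia mul1r.
  lra.
have : 0 <= u * (v * (1 - u)).
  apply: mulr_ge0; first exact: ltW.
  by apply: mulr_ge0; [exact: ltW|rewrite subr_ge0].
have : u * (u - v) = u * (u * v) by rewrite uv.
lra.
Qed.

(* Chebyshev along the squares, where the variances are summable; between
   consecutive squares the count moves by at most their distance. *)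
Lemma slln_events :
  {ae P, forall w, N%:R^-1 * \sum_(k <- iota 0 N) (\1_(D k) w : R) @[N --> \oo] --> p}.
Proof.
pose f m w := ((count (m.+1 ^ 2) w - (m.+1 ^ 2)%:R * p) / (m.+1 ^ 2)%:R) ^+ 2.
have : {ae P, forall w, f m w @[m --> \oo] --> 0}.
  apply: (@ae_cvg0_summable f (fun m => (m.+1%:R ^+ 2)^-1) 2) => //.
  - move=> m; apply: measurable_funX; apply: measurable_funM => //.
    exact: measurable_funB.
  - by move=> m w; exact: sqr_ge0.
  - move=> m; pose c : R := (((m.+1 ^ 2)%:R)^-1) ^+ 2.
    rewrite (eq_integral (fun w =>
      c%:E * ((count (m.+1 ^ 2) w - (m.+1 ^ 2)%:R * p) ^+ 2)%:E)%E); last first.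
      by move=> w _; rewrite -EFinM /f /c exprMn mulrC.
    rewrite ge0_integralZl_EFin//; last 3 first.
    + by move=> w _; rewrite lee_fin sqr_ge0.
    + apply/measurable_EFinP; apply: measurable_funX.
      exact: measurable_funB.
    + exact: sqr_ge0.
    apply: (le_trans (lee_wpmul2l _ (second_moment _))).
      by rewrite lee_fin sqr_ge0.
    rewrite -EFinM lee_fin /c expr2 -mulrA mulVf ?pnatr_eq0 ?expn_eq0// mulr1.
    by rewrite natrX.
apply: filterS => w fw; apply/cvgrPdist_le => e e0.
have e2 : 0 < (e / 2) ^+ 2 by rewrite exprn_gt0// divr_gt0.
move/cvgrPdist_lt : fw => /(_ _ e2)[m0 _ fm0].
(* From [m.+1 ^ 2] to any [N < m.+2 ^ 2] the distance is at most [2 * m.+1], relatively at most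
   [2 / m.+1]. *)
have [m1 _ m1e] : \forall m \near \oo, 2 / m.+1%:R < e / 2.
  have e4 : 0 < e / 4 by rewrite divr_gt0.
  have := near_infty_natSinv_lt (PosNum e4); apply: filterS => m me.
  have {}me : m.+1%:R^-1 < e / 4 := me.
  by set u := m.+1%:R^-1 in me *; lra.
exists ((maxn m0 m1).+1 ^ 2)%N => // N /= N0.
have [m [m0m m1m mN Nm]] : exists m, [/\ (m0 <= m)%N, (m1 <= m)%N,
    (m.+1 ^ 2 <= N)%N & (N < m.+2 ^ 2)%N].
  have ex : exists m, (m.+1 ^ 2 <= N)%N by exists (maxn m0 m1).
  have ub m : (m.+1 ^ 2 <= N)%N -> (m <= N)%N.
    by move=> /(leq_trans _); apply; rewrite (leq_trans (leqnSn m))// -{1}[m.+1]expn1 leq_pexp2l.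
  case: (ex_maxnP ex ub) => m mN mmax; exists m.
  have := mmax _ N0; rewrite geq_max => /andP[-> ->]; split => //.
  by rewrite ltnNge; apply/negP => /mmax; rewrite ltnn.
set n := (m.+1 ^ 2)%N in mN.
have n0 : (0 < n)%N by rewrite expn_gt0.
have nR : 0 < n%:R :> R by rewrite ltr0n.
have NR : 0 < N%:R :> R by rewrite ltr0n (leq_trans n0).
have countN : count N w = count n w + \sum_(k <- iota n (N - n)) \1_(D k) w.
  by rewrite /count -[in LHS](subnKC mN) iotaD big_cat add0n.
have r0 : 0 <= \sum_(k <- iota n (N - n)) (\1_(D k) w : R).
  by apply: sumr_ge0 => k _; rewrite indicE.
have r1 : \sum_(k <- iota n (N - n)) (\1_(D k) w : R) <= N%:R - n%:R.
  rewrite -natrB// -[in leRHS](size_iota n (N - n)) -sum1_size natr_sum.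
  by apply: ler_sum => k _; rewrite indicE lern1 leq_b1.
have gap : N%:R - n%:R <= 2 * m.+1%:R :> R.
  rewrite -natrB// -natrM ler_nat leq_subLR -ltnS (leq_trans Nm)//.
  by rewrite /n -[m.+2]addn1 sqrnD muln1 exp1n addn1 addSn.
have fm : `|(count n w - n%:R * p) / n%:R| < e / 2.
  have := fm0 m m0m; rewrite sub0r normrN ger0_norm ?sqr_ge0// -/n => fme.
  rewrite ltNge; apply/negP => ef; move: fme; rewrite ltNge => /negP; apply.
  rewrite -[X in _ <= X]real_normK ?num_real// lerXn2r// nnegrE.
  by rewrite divr_ge0 ?ltW.
have m1e' := m1e m m1m.
have nE : n%:R = m.+1%:R * m.+1%:R :> R by rewrite /n natrX expr2.
have mR : 0 < m.+1%:R :> R by rewrite ltr0n.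
set c := \sum_(k <- _) _; rewrite -/(count N w) in c *.
rewrite (_ : p - N%:R^-1 * c = - ((c - N%:R * p) / N%:R)); last first.
  by rewrite mulrBl mulrAC divff ?mul1r ?lt0r_neq0// opprB [c / _]mulrC.
rewrite normrN normrM normfV (gtr0_norm NR) ler_pdivrMr//.
move: fm; rewrite normrM normfV (gtr0_norm nR) ltr_pdivrMr// => fm.
move: m1e'; rewrite ltr_pdivrMr// => m1e'.
have nN : n%:R <= N%:R :> R by rewrite ler_nat.
have h1 : 2 * m.+1%:R <= e / 2 * n%:R.
  by rewrite nE mulrA ler_wpM2r// ltW.
apply: (@le_trans _ _ (e * n%:R)); last by rewrite ler_wpM2l// ltW.
rewrite /c -/(count N w) countN.
set r := \sum_(k <- _) _ in r0 r1 *.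
rewrite (_ : _ + r - _ = (count n w - n%:R * p) + (r - (N%:R - n%:R) * p)); last by lra.
rewrite (le_trans (ler_normD _ _))//.
have : `|r - (N%:R - n%:R) * p| <= N%:R - n%:R.
  have d0 : 0 <= N%:R - n%:R :> R by rewrite subr_ge0.
  have dp0 : 0 <= (N%:R - n%:R) * p by rewrite mulr_ge0.
  have dp1 : (N%:R - n%:R) * p <= N%:R - n%:R by rewrite ler_piMr.
  by rewrite ler_norml; apply/andP; split; lra.
lra.
Qed.

End events.

End almost_sure.

(** * Laws given by distribution functions, atoms and ties *)

Section law.
Variables (R : realType) (d : measure_display) (Omega : measurableType d).
Variable P : probability Omega R.

Lemma law_of_cdf (F : cumulativeBounded (0 : R) (1 : R)) (X : {RV P >-> R}) :
  (forall y, cdf X y = (F y)%:E) ->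
  forall A : set R, measurable A ->
    P (X @^-1` A) = lebesgue_stieltjes_measure F A.
Proof.
move=> XF A mA; apply/esym.
have mX : measurable_fun [set: Omega] (X : Omega -> measurableTypeR R).
  by move=> _ B mB; exact: (measurable_funPT X measurableT).
pose X' : {mfun Omega >-> measurableTypeR R} :=
  HB.pack (X : Omega -> measurableTypeR R) (isMeasurableFun.Build _ _ _ _ _ mX).
apply: (lebesgue_stieltjes_measure_unique (f := F) (mu := pushforward P X')) => // I [[a b]]/= _ <-.
rewrite /lebesgue_stieltjes_measure /measure_extension/=.
rewrite measurable_mu_extE/=; last exact: is_ocitv.
have [ab|ba] := leP a b; last first.
  by rewrite set_itv_ge ?wlength0 ?measure0// bnd_simp -leNgt ltW.
rewrite wlength_itv_bnd// EFinB -!XF /cdf /distribution /pushforward.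
have -> : `]a, b]%classic = `]-oo, b] `\` `]-oo, a].
  by rewrite -[RHS]setCK setCD setCitvl setUC -[LHS]setCK setCitv.
rewrite [X @^-1` (_ `\` _)](_ : _ = X @^-1` `]-oo, b] `\` X @^-1` `]-oo, a])//.
rewrite measureD ?setIidr//.
- by apply: preimage_subset; exact: subset_itvl.
- exact: measurable_funPTI.
- exact: measurable_funPTI.
- by rewrite -ge0_fin_numE// fin_num_measure//; exact: measurable_funPTI.
Qed.

End law.

Section no_atom.
Variables (R : realType) (F : cumulativeBounded (0 : R) (1 : R)).
Hypothesis cF : continuous F.
Let mu := lebesgue_stieltjes_measure F.

Lemma lebesgue_stieltjes_oc a b : a <= b -> mu `]a, b] = (F b - F a)%:E.
Proof.
move=> ab; rewrite /mu /lebesgue_stieltjes_measure /measure_extension/=.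
by rewrite measurable_mu_extE/= ?wlength_itv_bnd//; exact: is_ocitv.
Qed.

Lemma lebesgue_stieltjes_set1 (v : R) : mu [set v] = 0%E.
Proof.
apply/eqP; rewrite eq_le measure_ge0 andbT; apply/lee_addgt0Pr => e e0.
have /cvgrPdist_lt/(_ _ e0)/nbhs_ballP[r /= r0 Fr] : F x @[x --> v] --> F v := @cF v.
have r2 : 0 < r / 2 by rewrite divr_gt0.
apply: (@le_trans _ _ (mu `](v - r / 2), v])).
  by apply: le_measure; rewrite ?inE// => x /= ->; rewrite in_itv/= lexx andbT; lra.
rewrite lebesgue_stieltjes_oc; last by lra.
rewrite add0e lee_fin (le_trans (ler_norm _))// ltW//; apply: Fr.
rewrite /ball/= opprB addrC subrK gtr0_norm//; lra.
Qed.

Lemma lebesgue_stieltjes_Nyo v : mu `]-oo, v[ = (F v)%:E.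
Proof.
rewrite -lebesgue_stieltjes_Nyc -(setUitv1 (a := -oo%O) true)// measureU//.
  by rewrite [X in (_ + X)%E](lebesgue_stieltjes_set1 v) adde0.
by apply/seteqP; split => // x [/= + xv]; rewrite xv in_itv/= ltxx.
Qed.

Lemma lebesgue_stieltjes_cy v : mu `[v, +oo[ = (1 - F v)%:E.
Proof.
have mI : measurable (`]-oo, v[%classic : set (measurableTypeR R)).
  exact: measurable_itv.
have := probability_setC (lebesgue_stieltjes_measure F) mI.
by rewrite setCitvl => muE; rewrite [LHS]muE EFinB -lebesgue_stieltjes_Nyo//.
Qed.

Lemma lebesgue_stieltjes_co a b : a <= b -> mu `[a, b[ = (F b - F a)%:E.
Proof.
move=> ab; have -> : `[a, b[%classic = `]-oo, b[ `\` `]-oo, a[.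
  by rewrite -[RHS]setCK setCD setCitvl setUC -[LHS]setCK setCitv.
have mI c : measurable (`]-oo, c[%classic : set (measurableTypeR R)).
  exact: measurable_itv.
have fin : (lebesgue_stieltjes_measure F `]-oo, b[ < +oo)%E.
  by rewrite -ge0_fin_numE// fin_num_measure.
have := measureD (mI b) (mI a) fin; rewrite setIidr; last exact: subset_itvl.
by move=> muE; rewrite [LHS]muE EFinB -!lebesgue_stieltjes_Nyo.
Qed.

End no_atom.

Section ties.
Variables (R : realType) (d : measure_display) (Omega : measurableType d).
Variables (P : probability Omega R) (Y T : nat -> {RV P >-> R}).
Hypothesis indep : mutually_independent P (fun k w => (Y k w, T k w) : R * R).
Hypothesis atomless : forall k v, P (Y k @^-1` [set v]) = 0%E.

(** The joint law of [Y k] and [Y l] is a product measure; the sections of the diagonal are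
    singletons, which are null. *)
Lemma ae_no_ties :
  {ae P, forall w, forall k l, k <> l -> Y k w <> Y l w}.
Proof.
apply/ae_foralln => k; apply/ae_foralln => l.
have [->|kl] := eqVneq k l; first exact: aeW.
pose D : set (R * R) := [set z | z.1 = z.2].
have mD : measurable D.
  rewrite (_ : D = [set z : R * R | z.1 <= z.2] `&` [set z | z.2 <= z.1]).
    by apply: measurableI; apply: measurable_set_ler.
  by apply/seteqP; split => [z /= ->|z /= [h1 h2]]; [|apply/eqP; rewrite eq_le h1].
have mX : measurable_fun [set: Omega] (fun w => (Y k w, Y l w)).
  by apply/measurable_fun_pairP; split; exact: measurable_funPT.
pose X : {mfun Omega >-> (R * R)%type} :=
  HB.pack (fun w => (Y k w, Y l w)) (isMeasurableFun.Build _ _ _ _ _ mX).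
have := @product_measure_unique _ _ _ _ R (distribution P (Y k))
  (distribution P (Y l)) (pushforward P X) _ D mD.
move=> XD; exists (X @^-1` D); split.
- exact: measurable_funPTI.
- rewrite -[LHS]/(pushforward P X D) -(XD mX).
    rewrite /= /product_measure1/= integral0_eq// => x _.
    rewrite (_ : xsection D x = [set x]); first exact: atomless.
    by apply/seteqP; split => y; rewrite /xsection/= inE.
  move=> A B mA mB; rewrite /= /pushforward.
  pose E i : set (R * R) :=
    if i == k then A `*` setT else if i == l then B `*` setT else setT.
  have mE i : measurable (E i : set (R * R)).
    by rewrite /E; case: ifP => _; [exact: measurableX|case: ifP => _; [exact: measurableX|]].
  have := indep (J := [:: k; l]) (A := E) _ mE.
  rewrite /= inE kl => /(_ isT); rewrite !big_cons big_nil mule1.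
  rewrite /E eqxx [l == k]eq_sym (negbTE kl) eqxx => kE.
  transitivity (P (\bigcap_(i in [set` [:: k; l]]) ((fun w => (Y i w, T i w) : R * R) @^-1` E i))).
    congr (P _); apply/seteqP; split => w /=.
      move=> [Aw Bw] i /=; rewrite !inE => /orP[/eqP->|/eqP->].
        by rewrite /E eqxx.
      by rewrite /E eq_sym (negbTE kl) eqxx.
    move=> h; split.
      by have := h k; rewrite /= !inE eqxx /E eqxx => /(_ isT)[].
    by have := h l; rewrite /= !inE eqxx orbT /E eq_sym (negbTE kl) eqxx => /(_ isT)[].
  rewrite [LHS]kE; congr (P _ * P _)%E.
  - by apply/seteqP; split => w //= [].
  - by apply/seteqP; split => w //= [].
move=> w /= /not_implyP[_ /contrapT]//.
Qed.

End ties.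

(** * Measurable covers and brackets *)

Section cover.
Variables (d : measure_display) (Omega : measurableType d) (R : realType).
Variable P : probability Omega R.

(** [B] is the intersection of measurable supersets of [A] with probabilities approaching the
    infimum [s]. As [B] cut with [C] is again such a superset, it has probability at least [s], and
    nothing is left for the difference. *)
Lemma measurable_hull (A : set Omega) : exists B, [/\ measurable B, A `<=` B &
  forall C, measurable C -> A `<=` C -> P (B `\` C) = 0%E].
Proof.
pose S := [set P C | C in [set C | measurable C /\ A `<=` C]].
pose s := ereal_inf S.
have S1 : S 1%E by exists setT; [split|exact: probability_setT].
have s0 : (0 <= s)%E by apply: le_ereal_inf_tmp => _ [C _ <-].
have sfin : s \is a fin_num.
  by rewrite ge0_fin_numE// (le_lt_trans (ereal_inf_lbound S1))// ltry.
have : forall n : nat, exists C, [/\ measurable C, A `<=` C & (P C <= s + n.+1%:R^-1%:E)%E].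
  move=> n; have n0 : 0 < n.+1%:R^-1 :> R by rewrite invr_gt0 ltr0n.
  have [_ [C [mC AC] <-] /ltW sC] := lb_ereal_inf_adherent n0 sfin.
  by exists C.
move=> /choice[C hC]; exists (\bigcap_n C n).
have mC n : measurable (C n) by have [] := hC n.
have mB : measurable (\bigcap_n C n) by exact: bigcapT_measurable.
have AB : A `<=` \bigcap_n C n by move=> w Aw n _; have [_ + _] := hC n; apply.
split => // D mD AD.
have PB : (P (\bigcap_n C n) <= s)%E.
  apply/lee_addgt0Pr => e e0.
  have [n _ /(_ n (leqnn n)) /ltW ne] := near_infty_natSinv_lt (PosNum e0).
  apply: (@le_trans _ _ (P (C n))).
    by apply: le_measure; rewrite ?inE// => w; apply.
  have [_ _ /le_trans] := hC n; apply.
  by rewrite leeD2l// lee_fin.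
have PBD : (s <= P (\bigcap_n C n `&` D))%E.
  apply: ereal_inf_lbound; exists (\bigcap_n C n `&` D) => //; split.
    exact: measurableI.
  by move=> w Aw; split; [exact: AB|exact: AD].
apply/eqP; rewrite eq_le measure_ge0 andbT measureD//.
  by rewrite sube_le0 (le_trans PB).
by rewrite (le_lt_trans (probability_le1 _ _))// ltry.
Qed.

Lemma ereal_rat_between (x y : \bar R) : (x < y)%E ->
  exists q : rat, (x < (ratr q)%:E < y)%E.
Proof.
case: x => [x| |]; case: y => [y| |]//; rewrite ?lte_fin => xy.
- have [q] := rat_in_itvoo xy; rewrite in_itv/= => /andP[h1 h2].
  by exists q; rewrite !lte_fin h1.
- have [|q] := @rat_in_itvoo R x (x + 1); first by rewrite ltrDl.
  by rewrite in_itv/= => /andP[h1 h2]; exists q; rewrite lte_fin h1 ltry.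
- have [|q] := @rat_in_itvoo R (y - 1) y; first by rewrite gtrBl.
  by rewrite in_itv/= => /andP[h1 h2]; exists q; rewrite lte_fin h2 ltNyr.
- by exists 0; rewrite ltry ltNyr.
Qed.

(** The cover is the supremum over nonnegative rationals [q] of [q] times the indicator of a hull of
    the set where [f > q]. Countably many hulls keep it measurable and the exceptional sets null. *)
Lemma exists_measurable_cover (f : Omega -> \bar R) :
  (forall w, 0 <= f w)%E -> exists g, is_measurable_cover P f g.
Proof.
move=> f0; pose q n : R := `|ratr (odflt 0 (unpickle n : option rat))|.
have : forall n, exists B, [/\ measurable B, [set w | ((q n)%:E < f w)%E] `<=` B &
    forall C, measurable C -> [set w | ((q n)%:E < f w)%E] `<=` C -> P (B `\` C) = 0%E].
  by move=> n; exact: measurable_hull.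
move=> /choice[B hB].
have mB n : measurable (B n) by have [] := hB n.
pose h n w : \bar R := (q n * \1_(B n) w)%:E.
have h0 n w : (0 <= h n w)%E by rewrite lee_fin indicE mulr_ge0 ?normr_ge0 ?ler0n.
have mh n : measurable_fun setT (h n).
  by apply/measurable_EFinP; apply: measurable_funM => //; exact: measurable_indic.
pose g w := esups (h ^~ w) 0%N.
have hg n w : (h n w <= g w)%E.
  by apply: ereal_sup_ubound; exists n.
have fg w : (f w <= g w)%E.
  rewrite leNgt; apply/negP => /ereal_rat_between[r /andP[gr rf]].
  have r0 : 0 <= ratr r :> R.
    by rewrite -lee_fin (le_trans (le_trans (h0 0%N w) (hg 0%N w)) (ltW gr)).
  have qr : q (pickle r) = ratr r by rewrite /q pickleK/= ger0_norm.
  have Bw : w \in B (pickle r).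
    by apply/mem_set; have [_ + _] := hB (pickle r); apply; rewrite /= qr.
  have := hg (pickle r) w; rewrite /h indicE Bw mulr1 qr.
  by rewrite leNgt gr.
exists g; split => //; first exact: measurable_fun_esups.
move=> k mk [N [mN N0 fkN]].
(* A measurable set containing the one where [f > q n], hence almost all of the hull [B n]. *)
pose C n := [set w | ((q n)%:E < k w)%E] `|` N.
have mC n : measurable (C n).
  apply: measurableU => //; rewrite -[X in measurable X]setTI.
  exact: emeasurable_fun_o_infty.
have BC n : P (B n `\` C n) = 0%E.
  have [_ _] := hB n; apply => // w /= qf.
  have [fk|fk] := pselect (f w <= k w)%E; last by right; apply: fkN.
  by left; exact: lt_le_trans qf fk.
have nBC : P.-negligible (\bigcup_n (B n `\` C n)).
  apply: negligible_bigcup => n; exists (B n `\` C n); split => //.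
    exact: measurableD.
  exact: BC.
have nN : P.-negligible N by exists N; split.
apply: negligibleS (negligibleU nBC nN) => w /= gk; apply: contrapT => /not_orP[wBC wN].
apply: gk; apply: ge_ereal_sup => _ [n _ <-].
have fk : (f w <= k w)%E by apply: contrapT => fk; apply: wN; exact: fkN.
rewrite /h indicE; case: (boolP (w \in B n)) => [/set_mem wB|_]; last first.
  by rewrite mulr0 (le_trans (f0 w)).
rewrite mulr1; apply: contrapT => /negP; rewrite -ltNge => kq.
apply: wBC; exists n => //; split => // -[|//]; rewrite /= ltNge.
by rewrite (ltW kq).
Qed.

End cover.

Section bracketing.
Variables (R : realType) (mu : {measure set (measurableTypeR R) -> \bar R}).
Variable s : seq (R * R).
Hypotheses (us : uniq (map fst s)) (trs : {in s, forall p, p.2 <= p.1}).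

Let err (phi : R -> R) : R := `|estimate s phi - \int[mu]_y phi y|.

Let EFin_Rintegral (phi : R -> R) : L1 mu phi ->
  (\int[mu]_y phi y)%:E = (\int[mu]_y (phi y)%:E)%E.
Proof. by move=> iphi; rewrite /Rintegral fineK//; exact: integrable_fin_num. Qed.

(** The weights are nonnegative, so [estimate] is monotone, and so is the integral; [phi] is
    squeezed between [l] and [u], whose integrals differ by at most [eps]. *)
Lemma estimate_bracket eps (l u phi : R -> R) : is_bracket mu eps l u ->
  L1 mu phi -> bracket l u phi -> err phi <= eps + (err l + err u).
Proof.
move=> [il iu luE] iphi lphiu.
have lphi y : l y <= phi y by have /andP[] := lphiu y.
have phiu y : phi y <= u y by have /andP[] := lphiu y.
have iul : L1 mu (fun y => u y - l y) := integrableB measurableT iu il.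
have lu : \int[mu]_y u y - \int[mu]_y l y <= eps.
  rewrite -RintegralB// -lee_fin EFin_Rintegral//.
  apply/ltW/(le_lt_trans _ luE); apply: ge0_le_integral => //.
  - by move=> y _; rewrite lee_fin subr_ge0 (le_trans (lphi y)).
  - exact: measurable_int iul.
  - by apply/measurable_EFinP; apply: measurableT_comp => //;
      apply/measurable_EFinP; exact: measurable_int iul.
  - by move=> y _; rewrite lee_fin ler_norm.
have h1 : \int[mu]_y l y <= \int[mu]_y phi y by apply: le_Rintegral.
have h2 : \int[mu]_y phi y <= \int[mu]_y u y by apply: le_Rintegral.
have h3 := ler_estimate s lphi; have h4 := ler_estimate s phiu.
rewrite /err ler_norml; apply/andP; split.
  have := ler_norm (- (estimate s l - \int[mu]_y l y)); rewrite normrN.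
  have := normr_ge0 (estimate s u - \int[mu]_y u y); lra.
have := ler_norm (estimate s u - \int[mu]_y u y).
have := normr_ge0 (estimate s l - \int[mu]_y l y); lra.
Qed.

Lemma sup_deviation_le eps m (l u : 'I_m -> R -> R) (FF : set (R -> R)) :
  0 <= eps -> (forall i, is_bracket mu eps (l i) (u i)) ->
  FF `<=` \bigcup_(i in [set: 'I_m]) bracket (l i) (u i) -> FF `<=` L1 mu ->
  (sup_deviation (lebesgue_stieltjes_measure (lynden_bell s)) mu FF <=
    (eps + \sum_(i < m) (err (l i) + err (u i)))%:E)%E.
Proof.
move=> eps0 lu FFlu FF1; have err0 i : 0 <= err (l i) + err (u i) by rewrite /err addr_ge0.
rewrite /sup_deviation ge_max lee_fin addr_ge0 ?sumr_ge0//=.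
apply: ge_ereal_sup => _ [phi FFphi <-].
have [i _ phii] := FFlu _ FFphi; have iphi := FF1 _ FFphi.
have mphi : measurable_fun [set: measurableTypeR R] phi.
  by apply/measurable_EFinP; exact: measurable_int iphi.
rewrite integral_lynden_bell// -EFin_Rintegral// -EFinB lee_fin.
apply: (le_trans (estimate_bracket (lu i) iphi phii)).
by rewrite lerD2l (bigD1 i)//= lerDl sumr_ge0.
Qed.

End bracketing.

(** * Consistency *)

(* [S], [S'] stand for [surv], [sb], [tb] for [1 - F] and [c], [c'] for the risk
   at two points, the hypotheses for [surv_increment_bounds]. *)
Lemma ratio_increment_le (R : realType) (S S' c c' A1 A2 sb tb : R) : 0 < c -> 0 < c' ->
  0 < tb -> tb <= sb -> 0 <= S' -> S' <= 1 -> 0 <= S -> S <= 1 ->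
  S' * A1 <= (S - S') * c' -> (S - S') * c <= S * A2 ->
  `|S / sb - S' / tb| <=
    tb ^- 2 * (`|sb * A2 / c - (sb - tb)| + `|tb * A1 / c' - (sb - tb)|).
Proof.
move=> c0 c'0 tb0 tsb S'0 S'1 S0 S1.
have sb0 : 0 < sb by exact: lt_le_trans tb0 tsb.
have -> : S' * A1 <= (S - S') * c' = (S' * A1 / c' <= S - S') by rewrite ler_pdivrMr.
have -> : (S - S') * c <= S * A2 = (S - S' <= S * A2 / c) by rewrite ler_pdivlMr.
pose q := S / sb; pose q' := S' / tb.
have SE : S = q * sb by rewrite /q divfK// gt_eqF.
have S'E : S' = q' * tb by rewrite /q' divfK// gt_eqF.
have q0 : 0 <= q by rewrite divr_ge0// ltW.
have q'0 : 0 <= q' by rewrite divr_ge0// ltW.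
(* The ratios are at most [1 / tb]; with the division by [tb] below this accounts for [tb ^- 2]. *)
have qt : q * tb <= 1 by rewrite (le_trans _ S1)// SE ler_wpM2l.
have q't : q' * tb <= 1 by rewrite -S'E.
set D := sb - tb; set U := sb * A2 / c; set L := tb * A1 / c'.
have -> : S * A2 / c = q * U by rewrite SE /U -!mulrA.
have -> : S' * A1 / c' = q' * L by rewrite S'E /L -!mulrA.
rewrite -/q -/q' => hL hU.
have t2 : 0 < tb ^+ 2 by rewrite exprn_gt0.
rewrite ler_pdivlMl// expr2.
have DE : S - S' = q * sb - q' * tb by rewrite -SE -S'E.
rewrite DE in hL hU.
have uU := ler_norm (U - D); have lL := ler_norm (- (L - D)).
have nU := normr_ge0 (U - D); have nL := normr_ge0 (L - D).
rewrite normrN in lL.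
have sbE : sb = D + tb by rewrite /D subrK.
have D0 : 0 <= D by rewrite subr_ge0.
(* A falling ratio is limited by the upper bound [hU] on [S - S'], a rising one by the lower bound
   [hL]. *)
have [qq|qq] := leP q' q.
  rewrite ger0_norm ?subr_ge0//.
  have h1 : (q - q') * tb <= q * (U - D) by rewrite sbE in hU; lra.
  have h2 : q * tb * (U - D) <= 1 * `|U - D|.
    apply: (le_trans (ler_wpM2l _ uU)); first by rewrite mulr_ge0// ltW.
    by rewrite ler_wpM2r.
  have h3 : tb * ((q - q') * tb) <= tb * (q * (U - D)) by rewrite ler_wpM2l// ltW.
  lra.
rewrite ltr0_norm ?subr_lt0// opprB.
have h1 : (q' - q) * tb <= q' * - (L - D).
  have : 0 <= (q' - q) * D by rewrite mulr_ge0// subr_ge0 ltW.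
  by rewrite sbE in hL; lra.
have h2 : q' * tb * - (L - D) <= 1 * `|L - D|.
  apply: (le_trans (ler_wpM2l _ lL)); first by rewrite mulr_ge0// ltW.
  by rewrite ler_wpM2r.
have h3 : tb * ((q' - q) * tb) <= tb * (q' * - (L - D)) by rewrite ler_wpM2l// ltW.
lra.
Qed.

Section consistency.
Variables (R : realType) (d : measure_display) (Omega : measurableType d).
Variables (P : probability Omega R) (F G : cumulativeBounded (0 : R) (1 : R)).
Variables Y T : nat -> {RV P >-> R}.
Hypotheses (cF : continuous F) (cG : continuous G).
Hypothesis YF : forall k y, cdf (Y k) y = (F y)%:E.
Hypothesis TG : forall k t, cdf (T k) t = (G t)%:E.
Hypothesis YT : forall k, independent_pair P (Y k) (T k).
Hypothesis indep : mutually_independent P (fun k w => (Y k w, T k w) : R * R).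
Hypothesis GF : (lower_endpoint G <= lower_endpoint F)%E.

Let mu := lebesgue_stieltjes_measure F.
Let nu := lebesgue_stieltjes_measure G.
Let Ymu k A : measurable A -> P (Y k @^-1` A) = mu A.
Proof. exact: law_of_cdf. Qed.
Let Tnu k A : measurable A -> P (T k @^-1` A) = nu A.
Proof. exact: law_of_cdf. Qed.

Let sample N w := observed_among Y T N w.

Let cdf_itv (K : cumulativeBounded (0 : R) (1 : R)) y : 0 <= K y <= 1.
Proof.
rewrite -!lee_fin -lebesgue_stieltjes_Nyc measure_ge0/=.
by apply: probability_le1; exact: measurable_itv.
Qed.

Let F_le x y : x <= y -> F x <= F y. Proof. exact: cumulative_is_nondecreasing. Qed.
Let G_le x y : x <= y -> G x <= G y. Proof. exact: cumulative_is_nondecreasing. Qed.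

Lemma quantile c : 0 < c < 1 -> exists a, F a = c.
Proof.
move=> /andP[c0 c1].
have [x0 Fx0] : exists x, F x < c.
  have /cvgrPdist_lt/(_ _ c0) := cumulativeNy F.
  move=> [M [Mreal h]]; exists (M - 1).
  have M1 : M - 1 < M by lra.
  have := h _ M1; rewrite sub0r normrN; exact: le_lt_trans (ler_norm _).
have [x1 Fx1] : exists x, c < F x.
  have d0 : 0 < 1 - c by lra.
  have /cvgrPdist_lt/(_ _ d0) := cumulativey F.
  move=> [M [Mreal h]]; exists (M + 1).
  have M1 : M < M + 1 by lra.
  have h1 := ler_norm (1 - F (M + 1)).
  by have h2 : `|1 - F (M + 1)| < 1 - c := h _ M1; lra.
have x01 : x0 <= x1.
  by rewrite leNgt; apply/negP => /ltW/F_le; lra.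
have [] := @IVT R F x0 x1 c x01.
- by apply: continuous_subspaceT; exact: cF.
- by apply/andP; split; rewrite ?ge_min ?le_max; apply/orP; [left|right]; lra.
by move=> a _ Fa; exists a.
Qed.

(** By continuity some [b < a] still has [F b > 0], which puts the lower endpoint of [F], and with
    it that of [G], strictly below [a]. So the mean risk is positive wherever [0 < F a < 1]. *)
Lemma G_gt0 a : 0 < F a -> 0 < G a.
Proof.
move=> Fa; have /andP[_ Fa1] := cdf_itv F a.
have [|b Fb] := @quantile (F a / 2); first lra.
have ba : b < a by rewrite ltNge; apply/negP => /F_le; lra.
have Fb0 : 0 < F b by lra.
have : (lower_endpoint G < a%:E)%E.
  apply: (le_lt_trans GF); apply: (@le_lt_trans _ _ b%:E); last by rewrite lte_fin.
  by apply: ereal_inf_lbound; exists b.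
move=> /ereal_inf_lt[_ [x /= Gx <-]]; rewrite lte_fin => /ltW xa.
exact: lt_le_trans Gx (G_le xa).
Qed.

Lemma estimate_le (phi : R -> R) a N w :
  (forall k l, k <> l -> Y k w <> Y l w) -> (forall y, 0 <= phi y) ->
  0 < risk (sample N w) a ->
  estimate (sample N w) phi <=
    risk_average (observed (fun y => phi y * (y <= a)%R%:R)) (@at_risk R)
      (iota 0 N) (latent Y T w) +
    N%:R / risk (sample N w) a *
    risk_average (fun z => phi z.1) (fun _ _ => true) (iota 0 N) (latent Y T w).
Proof.
move=> Yw phi0 ra; set s := sample N w in ra *.
have us : uniq (map fst (sample N w)) by exact: uniq_observed.
have trs : {in sample N w, forall p, p.2 <= p.1} by exact: observed_truncated.
have s0 p : p \in s -> 0 < risk s p.1.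
  by move=> ps; rewrite (lt_le_trans ltr01)// risk_ge1// trs.
apply: (@le_trans _ _ (\sum_(p <- s) (phi p.1 * (p.1 <= a)%R%:R / risk s p.1 +
    phi p.1 / risk s a))).
  rewrite /estimate big_seq [leRHS]big_seq; apply: ler_sum => p ps.
  have [pa|ap] := leP p.1 a.
    rewrite mulr1 -[leLHS]addr0; apply: lerD; last by rewrite divr_ge0 ?risk_ge0.
    by rewrite [leLHS]mulrC ler_wpM2l// jump_le.
  rewrite mulr0 mul0r add0r [leLHS]mulrC ler_wpM2l// -[leRHS]mul1r ler_pdivlMr//.
  by apply: jump_risk_le1 => //; exact: ltW.
rewrite big_split/= lerD//.
  rewrite sum_observed /risk_average big_mkcond/=; apply: ler_sum => k _.
  rewrite /observed/= risk_observed; case: ifPn => _; last by rewrite mul0r mul0r.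
  by rewrite mul1r.
rewrite -mulr_suml sum_observed.
have -> : risk_average (fun z => phi z.1) (fun _ _ => true) (iota 0 N) (latent Y T w) =
    (\sum_(k <- iota 0 N) phi (Y k w)) / N%:R.
  rewrite /risk_average mulr_suml; apply: eq_bigr => k _.
  by rewrite big_const_seq count_predT size_iota iter_addr_0.
have [N0|N0] := eqVneq N 0%N.
  by rewrite N0 !big_nil !mul0r.
have NR : N%:R != 0 :> R by rewrite pnatr_eq0.
rewrite [leRHS]mulrC mulrA divfK//.
rewrite ler_wpM2r ?invr_ge0 ?risk_ge0// big_mkcond/=; apply: ler_sum => k _.
by case: ifP.
Qed.

Lemma slln_rectangle (A B : set R) : measurable A -> measurable B ->
  {ae P, forall w, N%:R^-1 * \sum_(k <- iota 0 N)
    (\1_(Y k @^-1` A `&` T k @^-1` B) w : R) @[N --> \oo] -->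
    fine (mu A) * fine (nu B)}.
Proof.
move=> mA mB.
have PAB k : P (Y k @^-1` A `&` T k @^-1` B) = (fine (mu A) * fine (nu B))%:E.
  rewrite YT// (Ymu k mA) (Tnu k mB) EFinM !fineK//.
    by rewrite -(Tnu k mB) fin_num_measure//; exact: measurable_funPTI.
  by rewrite -(Ymu k mA) fin_num_measure//; exact: measurable_funPTI.
apply: slln_events => // [k|k l kl].
  by apply: measurableI; exact: measurable_funPTI.
have := indep (J := [:: k; l]) (A := fun=> A `*` B) _ (fun=> measurableX mA mB).
rewrite /= inE kl => /(_ isT); rewrite !big_cons big_nil mule1.
move=> kE; transitivity (P (\bigcap_(i in [set` [:: k; l]])
    ((fun w => (Y i w, T i w) : R * R) @^-1` (A `*` B)))).
  congr (P _); apply/seteqP; split => w /=.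
    by move=> [[? ?] [? ?]] i /=; rewrite !inE => /orP[/eqP->|/eqP->].
  by move=> h; split; apply: h; rewrite /= !inE eqxx ?orbT.
by rewrite [LHS]kE EFinM -{1}(PAB k) -(PAB l).
Qed.

Lemma mean_risk v :
  {ae P, forall w, N%:R^-1 * risk (sample N w) v @[N --> \oo] --> G v * (1 - F v)}.
Proof.
have := slln_rectangle (measurable_itv `[v, +oo[) (measurable_itv `]-oo, v]).
rewrite /mu /nu lebesgue_stieltjes_cy// lebesgue_stieltjes_Nyc/= mulrC.
apply: filterS => w; congr (cvg_to (_ @ \oo) _); apply/funext => N.
rewrite risk_observed; congr (_ * _); apply: eq_bigr => k _.
rewrite indicE; congr ((nat_of_bool _)%:R).
apply/idP/idP => [/set_mem/=|/andP[? ?]].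
  by rewrite !in_itv/= andbT => -[? ?]; apply/andP.
by apply/mem_set; rewrite /= !in_itv/= andbT.
Qed.

Lemma no_ties : {ae P, forall w, forall k l, k <> l -> Y k w <> Y l w}.
Proof.
apply: ae_no_ties indep _ => k v.
rewrite Ymu; last exact: measurable_set1.
exact: lebesgue_stieltjes_set1.
Qed.

(* The lower tail of the estimator is controlled by the averages of
   [phi / risk], the upper tail by plain averages of [phi]. *)
Lemma ae_estimate_small (phi : nat -> R -> R) (K : nat -> R) :
  (forall j, measurable_fun [set: R] (phi j)) -> (forall j y, 0 <= phi j y) ->
  (forall j, \int[mu]_y (phi j y)%:E <= (K j)%:E)%E ->
  (forall e : R, 0 < e -> exists j, K j <= e) ->
  {ae P, forall w, forall a, 0 < a ->
    exists j, \forall N \near \oo, estimate (sample N w) (phi j) <= a}.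
Proof.
move=> mphi phi0 phiK K0.
(* The tails are split at a median: [1 - F b = 1 / 2] produces the factor 2 in [EX], and the risk at
   [b] grows like [c * N] with [c > 0]. *)
have [|b Fb] := @quantile (1 / 2); first lra.
have Gb : 0 < G b by apply: G_gt0; lra.
pose c := G b * (1 - F b).
have c0 : 0 < c by rewrite mulr_gt0//; lra.
pose psi j y := phi j y * (y <= b)%R%:R.
have mpsi j : measurable_fun [set: R] (psi j).
  apply: measurable_funM => //; apply: measurable_fun_natb.
  exact: measurable_set_ler.
have psi0 j y : 0 <= psi j y by rewrite mulr_ge0.
pose X j N w := risk_average (observed (psi j)) (@at_risk R) (iota 0 N) (latent Y T w).
pose A j N w :=
  risk_average (fun z => phi j z.1) (fun _ _ => true) (iota 0 N) (latent Y T w).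
have mg j : measurable_fun setT (fun z : R * R => phi j z.1).
  exact: measurableT_comp (mphi j) measurable_fst.
have mtrue : measurable [set x : path_space R | true].
  by rewrite (_ : [set _ | _] = setT)//; apply/seteqP; split.
have EX j a : 0 < a ->
    (a%:E * P [set w | exists n, (a <= X j n w)%R] <= (2 * K j)%:E)%E.
  move=> a0; apply: (maximal_risk_average YT indep Ymu Tnu) => //.
  - exact: observed_ge0.
  - exact: observed_at_risk.
  - exact: measurable_observed.
  - exact: measurable_at_risk.
  move=> M.
  have psib y : b < y -> psi j y = 0.
    by move=> yb; rewrite /psi leNgt yb mulr0.
  have := risk_average_expectation YT indep Ymu Tnu (mpsi j) (psi0 j) M psib.
  set I := (\int[P]_w _)%E => hI.
  have {}hI : ((1 / 2)%:E * I <= (K j)%:E)%E.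
    rewrite (_ : 1 / 2 = 1 - F b); last by lra.
    apply: (le_trans hI); apply: le_trans (phiK j); apply: ge0_le_integral => //.
    - by move=> y _; rewrite lee_fin psi0.
    - by apply/measurable_EFinP; exact: mpsi.
    - by apply/measurable_EFinP; exact: mphi.
    - by move=> y _; rewrite lee_fin /psi ler_piMr// lern1 leq_b1.
  have half : (0 < (1 / 2 : R)%:E)%E by rewrite lte_fin; lra.
  rewrite -(lee_pmul2l _ half)//.
  by rewrite (le_trans hI)// -EFinM lee_fin; lra.
have EA j a : 0 < a ->
    (a%:E * P [set w | exists n, (a <= A j n w)%R] <= (K j)%:E)%E.
  move=> a0; apply: (maximal_risk_average YT indep Ymu Tnu) => //.
  move=> M; apply: le_trans (phiK j).
  exact: (mean_expectation T Ymu (mphi j) (phi0 j) M).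
have mEX j a : measurable [set w | exists n, (a <= X j n w)%R].
  apply: measurable_maximal; first exact: measurable_observed.
  exact: measurable_at_risk.
have mEA j a : measurable [set w | exists n, (a <= A j n w)%R].
  by apply: measurable_maximal.
pose E j a := [set w | exists n, (a <= X j n w)%R] `|` [set w | exists n, (a <= A j n w)%R].
have : {ae P, forall w, forall a, 0 < a -> exists j, ~ E j a w}.
  apply: (@ae_exists_small _ _ _ _ E (fun j => 3 * K j)).
  - by move=> j a; exact: measurableU.
  - move=> j a a' aa' w [[n h]|[n h]]; [left|right]; exists n;
      exact: le_trans aa' h.
  - move=> j a a0; apply: (@le_trans _ _ (a%:E * (P [set w | exists n, (a <= X j n w)%R]
        + P [set w | exists n, (a <= A j n w)%R]))%E).
      by rewrite lee_pmul2l ?lte_fin// measureU2.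
    rewrite ge0_muleDr// (le_trans (leeD (EX j a a0) (EA j a a0)))//.
    by rewrite -EFinD lee_fin; lra.
  - move=> e e0; have [|j Kj] := K0 (e / 3); first lra.
    by exists j; lra.
move=> hE; apply: filterS3 no_ties (mean_risk b) hE => w Yw Cw Ew a a0.
(* Each tail may contribute [a / 2]; since [N / risk] is eventually below [2 / c], the plain average
   has to stay below [a * c / 4]. *)
have a1 : 0 < Num.min (a / 2) (a * c / 4).
  by rewrite lt_min; apply/andP; split; [lra|rewrite divr_gt0// mulr_gt0].
have [j /not_orP[/forallNP Xj /forallNP Aj]] := Ew _ a1; exists j.
have c2 : 0 < c / 2 by lra.
move/cvgrPdist_lt : Cw => /(_ _ c2)[N0 _ CN].
exists N0.+1 => // N /= N0N.
have := CN N (ltnW N0N) => /=; rewrite -/c => cN.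
have NR : 0 < N%:R :> R by rewrite ltr0n (leq_trans _ N0N).
have rN : c / 2 < N%:R^-1 * risk (sample N w) b.
  by have := ler_norm (c - N%:R^-1 * risk (sample N w) b); lra.
have r0 : 0 < risk (sample N w) b.
  by rewrite -(@pmulr_rgt0 _ N%:R^-1) ?invr_gt0// (lt_trans c2).
have /negP := Xj N; rewrite -ltNge lt_min => /andP[X1 _].
have /negP := Aj N; rewrite -ltNge lt_min => /andP[_ A1].
have A0 : 0 <= A j N w by apply: risk_average_ge0 => z; exact: phi0.
apply: (le_trans (estimate_le Yw (phi0 j) r0)).
have : N%:R / risk (sample N w) b * A j N w <= a / 2.
  rewrite mulrAC ler_pdivrMr//.
  have h1 : N%:R * A j N w <= N%:R * (a * c / 4) by rewrite ler_wpM2l// ltW.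
  apply: (le_trans h1).
  move: rN; rewrite [ltRHS]mulrC ltr_pdivlMr// => rN.
  have : a / 2 * (c / 2 * N%:R) <= a / 2 * risk (sample N w) b.
    by rewrite ler_wpM2l// ?ltW//; lra.
  lra.
rewrite -/(X j N w) -/(A j N w).
lra.
Qed.

(** For [s <= Y < t], being observed follows from [T <= s] and implies [T <= t]. Both conditions
    describe rectangles, to which the strong law applies. *)
Lemma mean_observed_bounds N w s t :
  N%:R^-1 * \sum_(k <- iota 0 N)
    (\1_(Y k @^-1` `[s, t[ `&` T k @^-1` `]-oo, s]) w : R) <=
  N%:R^-1 * \sum_(p <- sample N w) (s <= p.1 < t)%R%:R <=
  N%:R^-1 * \sum_(k <- iota 0 N)
    (\1_(Y k @^-1` `[s, t[ `&` T k @^-1` `]-oo, t]) w : R).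
Proof.
rewrite (sum_observed _ _ (fun p => (s <= p.1 < t)%R%:R)).
apply/andP; split; rewrite ler_wpM2l ?invr_ge0//.
  rewrite [leRHS]big_mkcond/=; apply: ler_sum => k _; rewrite indicE.
  case: (boolP (w \in _)) => [/set_mem|_]; last by case: ifP.
  by rewrite /= !in_itv/= => -[/andP[sY Yt] Ts]; rewrite (le_trans Ts sY) sY Yt.
rewrite [leLHS]big_mkcond/=; apply: ler_sum => k _; rewrite indicE.
case: ifPn => // TY; case: andP => // -[sY Yt].
rewrite mem_set//= !in_itv/= sY Yt; split => //.
by rewrite (le_trans TY)// ltW.
Qed.

(** * The ratio of [surv] to [1 - F] *)

Let H v := F v + G v.

Let q N w v := surv (sample N w) v / (1 - F v).

(* The two averages that pin down the increment of [surv] over [s, t] differ only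
   by observations whose truncation time lies in [s, t]: the second factor
   [H t - H s]. *)
Lemma surv_ratio_increment a y : 0 < G a -> F y < 1 ->
  exists2 K, 0 <= K & forall s t, a <= s -> s <= t -> t <= y ->
  {ae P, forall w, forall e, 0 < e ->
    \forall N \near \oo, `|q N w s - q N w t| <= K * (H t - H s) ^+ 2 + e}.
Proof.
move=> Ga Fy; pose tau := 1 - F y.
have tau0 : 0 < tau by rewrite subr_gt0.
(* Two error terms, each at most [(H t - H s) ^+ 2 / G a], with the prefactor
   [tb ^- 2 <= tau ^- 2]. *)
exists (2 * tau ^- 2 * (G a)^-1).
  by rewrite !mulr_ge0 ?invr_ge0 ?exprn_ge0 ?ltW.
move=> s t ast st ty.
have Fst := F_le st; have Gst := G_le st; have Gas := G_le ast; have Fty := F_le ty.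
have A1 := slln_rectangle (measurable_itv `[s, t[) (measurable_itv `]-oo, s]).
have A2 := slln_rectangle (measurable_itv `[s, t[) (measurable_itv `]-oo, t]).
move: A1 A2; rewrite /mu /nu lebesgue_stieltjes_co// !lebesgue_stieltjes_Nyc/= => A1 A2.
apply: filterS2 (filterI no_ties (filterI A1 A2)) (filterI (mean_risk s) (mean_risk t)).
move=> w [Yw [A1w A2w]] [cs ct] e e0.
pose sb := 1 - F s; pose tb := 1 - F t.
have tb0 : 0 < tb by rewrite /tb; lra.
have sb0 : 0 < sb by rewrite /sb; lra.
have Gs0 : 0 < G s by lra.
have Gt0 : 0 < G t by lra.
pose a1 N : R := N%:R^-1 * \sum_(k <- iota 0 N)
    (\1_(Y k @^-1` `[s, t[ `&` T k @^-1` `]-oo, s]) w : R).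
pose a2 N : R := N%:R^-1 * \sum_(k <- iota 0 N)
    (\1_(Y k @^-1` `[s, t[ `&` T k @^-1` `]-oo, t]) w : R).
pose c v N := N%:R^-1 * risk (sample N w) v.
(* The bound of [ratio_increment_le] with all counts divided by [N]. In its limit [Binf] the
   first-order terms cancel, leaving products of an increment of [F] and one of [G]. *)
pose B N := tb ^- 2 * (`|sb * a2 N / c s N - (sb - tb)| + `|tb * a1 N / c t N - (sb - tb)|).
pose D := F t - F s.
pose Binf := tb ^- 2 * (`|sb * (D * G t) / (G s * sb) - D| + `|tb * (D * G s) / (G t * tb) - D|).
have Dst : sb - tb = D by rewrite /sb /tb /D; lra.
have BB : B N @[N --> \oo] --> Binf.
  rewrite /B Dst; apply: cvgMr; apply: cvgD; apply: cvg_norm; apply: cvgB; try exact: cvg_cst.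
    apply: cvgM; first by apply: cvgMr; exact: A2w.
    by apply: cvgV; [rewrite mulf_neq0// gt_eqF|exact: cs].
  apply: cvgM; first by apply: cvgMr; exact: A1w.
  by apply: cvgV; [rewrite mulf_neq0// gt_eqF|exact: ct].
have BinfK : Binf <= 2 * tau ^- 2 * (G a)^-1 * (H t - H s) ^+ 2.
  have D0 : 0 <= D by rewrite /D subr_ge0.
  have g0 : 0 <= G t - G s by rewrite subr_ge0.
  have cancel u v b' : 0 < u -> 0 < b' -> b' * (D * v) / (u * b') - D = D * (v - u) * u^-1.
    move=> u0 b0; have -> : b' * (D * v) / (u * b') = D * v * u^-1 * (b' * b'^-1).
      by rewrite invfM; lra.
    rewrite divff ?lt0r_neq0// mulr1.
    have : D * (u * u^-1) = D by rewrite divff ?lt0r_neq0// mulr1.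
    lra.
  have E1 := cancel _ (G t) _ Gs0 sb0; have E2 := cancel _ (G s) _ Gt0 tb0.
  have {}E2 : tb * (D * G s) / (G t * tb) - D = - (D * (G t - G s) * (G t)^-1).
    by rewrite E2; lra.
  have X0 : 0 <= D * (G t - G s) by rewrite mulr_ge0.
  have XV v : 0 < G v -> 0 <= D * (G t - G s) * (G v)^-1.
    by move=> v0; rewrite mulr_ge0// invr_ge0 ltW.
  rewrite /Binf E1 E2 normrN !ger0_norm; [|exact: XV|exact: XV].
  have inv_le v : a <= v -> (G v)^-1 <= (G a)^-1.
    move=> av; rewrite lef_pV2 ?posrE//; first exact: G_le.
    exact: lt_le_trans Ga (G_le av).
  have XH : D * (G t - G s) <= (H t - H s) ^+ 2.
    rewrite (_ : H t - H s = D + (G t - G s)); last by rewrite /H /D; lra.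
    rewrite sqrrD; have := sqr_ge0 D; have := sqr_ge0 (G t - G s); lra.
  have t2 : tb ^- 2 <= tau ^- 2.
    have tt : tau <= tb by rewrite /tau /tb; lra.
    by rewrite lef_pV2 ?posrE ?exprn_gt0// lerXn2r// nnegrE ltW.
  have g1 : 0 <= (G a)^-1 by rewrite invr_ge0 ltW.
  have -> : 2 * tau ^- 2 * (G a)^-1 * (H t - H s) ^+ 2 =
      tau ^- 2 * (2 * ((H t - H s) ^+ 2 * (G a)^-1)) by lra.
  apply: ler_pM => //.
  - by rewrite invr_ge0 exprn_ge0// ltW.
  - by apply: addr_ge0; exact: XV.
  have h1 : D * (G t - G s) / G s <= (H t - H s) ^+ 2 * (G a)^-1.
    by apply: ler_pM => //; [rewrite invr_ge0 ltW|exact: inv_le].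
  have h2 : D * (G t - G s) / G t <= (H t - H s) ^+ 2 * (G a)^-1.
    by apply: ler_pM => //; [rewrite invr_ge0 ltW|apply: inv_le; exact: le_trans st].
  lra.
have cpos v : 0 < G v * (1 - F v) -> c v N @[N --> \oo] --> G v * (1 - F v) ->
    \forall N \near \oo, 0 < c v N.
  by move=> v0 /cvgr_gt; apply.
have cs0 := cpos s (mulr_gt0 Gs0 sb0) cs; have ct0 := cpos t (mulr_gt0 Gt0 tb0) ct.
have Be : \forall N \near \oo, B N <= Binf + e.
  by apply: (cvgr_le Binf BB); rewrite ltrDl.
near=> N; apply: (@le_trans _ _ (B N)); last first.
  by rewrite (@le_trans _ _ (Binf + e)) ?lerD2r//; near: N.
have N0 : (0 < N)%N by near: N; exists 1%N.
have NR : 0 < N%:R^-1 :> R by rewrite invr_gt0 ltr0n.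
have us := uniq_observed T N Yw; have trs := @observed_truncated _ _ _ _ Y T N w.
have [I1 I2] := surv_increment_bounds us trs st.
have /andP[b1 b2] := mean_observed_bounds N w s t.
have S0 v : 0 <= surv (sample N w) v := surv_ge0 _ _.
apply: ratio_increment_le.
- by near: N.
- by near: N.
- by [].
- by rewrite /tb /sb; lra.
- exact: S0.
- exact: surv_le1.
- exact: S0.
- exact: surv_le1.
- rewrite /c [leRHS]mulrCA; apply: (@le_trans _ _ (N%:R^-1 * (surv (sample N w) t *
    \sum_(p <- sample N w) (s <= p.1 < t)%R%:R))).
    by rewrite [leRHS]mulrCA ler_wpM2l.
  by rewrite ler_wpM2l// ltW.
- rewrite /c [leLHS]mulrCA; apply: (@le_trans _ _ (N%:R^-1 * (surv (sample N w) s *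
    \sum_(p <- sample N w) (s <= p.1 < t)%R%:R))).
    by rewrite ler_wpM2l// ltW.
  by rewrite [leLHS]mulrCA ler_wpM2l.
Unshelve. all: by end_near. Qed.

(* A function with quadratic increments is constant: bisect repeatedly. *)
Lemma surv_ratio_cauchy a y : 0 < G a -> F y < 1 -> a <= y ->
  {ae P, forall w, forall e, 0 < e ->
    \forall N \near \oo, `|q N w a - q N w y| <= e}.
Proof.
move=> Ga Fy ay; have [K K0 step] := surv_ratio_increment Ga Fy.
have cH : continuous H.
  by move=> x; apply: cvgD; [exact: (@cF x)|exact: (@cG x)].
have bisect n s t : a <= s -> s <= t -> t <= y -> {ae P, forall w, forall e, 0 < e ->
    \forall N \near \oo, `|q N w s - q N w t| <= K * (H t - H s) ^+ 2 / 2 ^+ n + e}.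
  elim: n s t => [|n ih] s t ast st ty.
    by apply: filterS (step s t ast st ty) => w h e /h; rewrite expr0 divr1.
  have Hst : H s <= H t by rewrite /H lerD// ?F_le ?G_le.
  (* The cut halves the increment of [H], not the interval: each half has a quarter of the squared
     increment, so the total bound is halved. *)
  have [||u + Hu] := @IVT R H s t ((H s + H t) / 2) st.
  - by apply: continuous_subspaceT; exact: cH.
  - by apply/andP; split; rewrite ?ge_min ?le_max; apply/orP; [left|right]; lra.
  rewrite in_itv/= => /andP[su ut].
  apply: filterS2 (ih s u ast su (le_trans ut ty)) (ih u t (le_trans ast su) ut ty).
  move=> w h1 h2 e e0; have e2 : 0 < e / 2 by lra.
  apply: filterS2 (h1 _ e2) (h2 _ e2) => N; rewrite Hu.
  rewrite (_ : (H s + H t) / 2 - H s = (H t - H s) / 2); last by lra.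
  rewrite (_ : H t - (H s + H t) / 2 = (H t - H s) / 2); last by lra.
  have -> : K * ((H t - H s) / 2) ^+ 2 / 2 ^+ n = K * (H t - H s) ^+ 2 / 2 ^+ n.+1 / 2.
    by rewrite (exprSr (2 : R) n) invfM exprMn; lra.
  have := ler_distD (q N w u) (q N w s) (q N w t).
  set X := K * _ / _; lra.
have : {ae P, forall w, forall n e, 0 < e ->
    \forall N \near \oo, `|q N w a - q N w y| <= K * (H y - H a) ^+ 2 / 2 ^+ n + e}.
  by apply/ae_foralln => n; exact: bisect.
apply: filterS => w h e e0; have e2 : 0 < e / 2 by lra.
pose C := K * (H y - H a) ^+ 2.
have [n Cn] : exists n, C / 2 ^+ n <= e / 2.
  have := cvg_geometric (C : R^o) (_ : `|(1 / 2 : R)| < 1).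
  rewrite ger0_norm ?divr_ge0// => /(_ _)/cvgrPdist_le/(_ _ e2) [].
    by lra.
  move=> n _ /(_ n (leqnn n)) /=; rewrite /geometric/= sub0r normrN => Cn; exists n.
  by apply: le_trans Cn; rewrite (le_trans _ (ler_norm _))// div1r exprVn.
apply: filterS (h n _ e2) => N; rewrite -/C; lra.
Qed.

(** * The functions whose integrals converge almost surely *)

Lemma indic_integrable (A : set R) : measurable A -> L1 mu (\1_A : R -> R).
Proof.
move=> mA; exact: (integrable_indic (lebesgue_stieltjes_measure F)).
Qed.

Let L1_measurable phi : L1 mu phi -> measurable_fun [set: R] phi.
Proof. by move=> /measurable_int/measurable_EFinP. Qed.

(** [ae_estimate_small] applied to every shifted sequence makes the good index as large as
    desired. *)
Lemma ae_estimate_small_index (phi : nat -> R -> R) :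
  (forall j, measurable_fun [set: R] (phi j)) -> (forall j y, 0 <= phi j y) ->
  (forall j, \int[mu]_y (phi j y)%:E <= j.+1%:R^-1%:E)%E ->
  {ae P, forall w, forall a, 0 < a ->
    exists2 j, j.+1%:R^-1 <= a &
      \forall N \near \oo, estimate (sample N w) (phi j) <= a}.
Proof.
move=> mphi phi0 phiK.
have : {ae P, forall w, forall J a, 0 < a ->
    exists j, \forall N \near \oo, estimate (sample N w) (phi (J + j)%N) <= a}.
  apply/ae_foralln => J.
  apply: (@ae_estimate_small (fun j => phi (J + j)%N) (fun j => (J + j)%N.+1%:R^-1)) => //.
  move=> e e0; have [j _ /(_ j (leqnn j)) je] := near_infty_natSinv_lt (PosNum e0).
  exists j; apply: (le_trans _ (ltW je)).
  by rewrite lef_pV2 ?posrE ?ltr0n// ler_nat ltnS leq_addl.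
apply: filterS => w h a a0.
have [J _ /(_ J (leqnn J)) Ja] := near_infty_natSinv_lt (PosNum a0).
have [j hj] := h J a a0; exists (J + j)%N => //.
apply: (le_trans _ (ltW Ja)).
by rewrite lef_pV2 ?posrE ?ltr0n// ler_nat ltnS leq_addr.
Qed.

Definition consistent (phi : R -> R) : Prop :=
  {ae P, forall w, estimate (sample N w) phi @[N --> \oo] --> \int[mu]_y phi y}.

Lemma consistent_lim (phi : R -> R) (psi : nat -> R -> R) : L1 mu phi ->
  (forall j, L1 mu (psi j)) -> (forall j, consistent (psi j)) ->
  (forall j, \int[mu]_y (`|phi y - psi j y|)%:E <= j.+1%:R^-1%:E)%E ->
  consistent phi.
Proof.
move=> iphi ipsi cpsi phipsi.
have mdiff j : measurable_fun [set: R] (fun y => `|phi y - psi j y|).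
  by apply: measurableT_comp => //; apply: measurable_funB; exact: L1_measurable.
have := ae_estimate_small_index mdiff (fun j y => normr_ge0 _) phipsi.
move/ae_foralln : cpsi => cpsi; apply: filterS2 cpsi => w cw hw.
apply/cvgrPdist_le => e e0.
have e3 : 0 < e / 3 by rewrite divr_gt0.
have [j je hj] := hw _ e3.
have /cvgrPdist_le/(_ _ e3) cj := cw j.
apply: filterS2 hj cj => N hN cN.
have d1 : `|\int[mu]_y phi y - \int[mu]_y psi j y| <= e / 3.
  rewrite -RintegralB//; last exact: ipsi.
  have idiff : mu.-integrable setT (EFin \o (fun y => phi y - psi j y)).
    exact: (integrableB measurableT iphi (ipsi j)).
  apply: (le_trans (le_normr_Rintegral measurableT idiff)).
  rewrite (le_trans _ je)// /Rintegral -lee_fin fineK.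
    exact: phipsi.
  rewrite ge0_fin_numE; last by apply: integral_ge0 => y _; rewrite lee_fin.
  exact: le_lt_trans (phipsi j) (ltry _).
have d2 := estimate_dist (sample N w) phi (psi j).
have := ler_distD (\int[mu]_y psi j y) (\int[mu]_y phi y) (estimate (sample N w) phi).
have := ler_distD (estimate (sample N w) (psi j)) (\int[mu]_y psi j y) (estimate (sample N w) phi).
rewrite [`|estimate _ (psi j) - _|]distrC; lra.
Qed.

Lemma consistentD phi psi : L1 mu phi -> L1 mu psi ->
  consistent phi -> consistent psi -> consistent (fun y => phi y + psi y).
Proof.
move=> iphi ipsi; apply: filterS2 => w h1 h2; rewrite RintegralD//.
by under eq_fun do rewrite estimateD; exact: cvgD.
Qed.

Lemma consistentZ c phi : L1 mu phi ->
  consistent phi -> consistent (fun y => c * phi y).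
Proof.
move=> iphi; apply: filterS => w h; rewrite RintegralZl//.
by under eq_fun do rewrite estimateZ; exact: cvgMr.
Qed.

Lemma Rintegral_indic (A : set R) : measurable A -> \int[mu]_y (\1_A y) = fine (mu A).
Proof. by move=> mA; rewrite /Rintegral integral_indic ?setIT. Qed.

(** All integrals being 0, the constant sequence [\1_A] qualifies for the bound on small
    functions. *)
Lemma consistent_null (A : set R) : measurable A -> mu A = 0%E -> consistent \1_A.
Proof.
move=> mA A0; rewrite /consistent Rintegral_indic// A0/=.
have A1 (y : R) : 0 <= \1_A y :> R by rewrite indicE.
have muA (j : nat) : (\int[mu]_y (\1_A y)%:E <= (j.+1%:R^-1)%:E)%E.
  by rewrite integral_indic// setIT [X in (X <= _)%E]A0 lee_fin invr_ge0.
apply: filterS (ae_estimate_small_index (fun=> measurable_indic mA) (fun=> A1) muA).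
move=> w h; apply/cvgrPdist_le => e e0; have [_ _] := h e e0.
apply: filterS => N; rewrite sub0r normrN ger0_norm// sumr_ge0// => p _.
by rewrite mulr_ge0 ?jump_ge0.
Qed.

Lemma estimate_ray N w y : (forall k l, k <> l -> Y k w <> Y l w) ->
  estimate (sample N w) \1_`]-oo, y[ = 1 - surv (sample N w) y.
Proof.
move=> Yw; rewrite surv_telescope; [|exact: uniq_observed|exact: observed_truncated].
rewrite /estimate [RHS]big_mkcond/=; apply: eq_bigr => p _.
by rewrite indicE mem_setE in_itv/=; case: ltP; rewrite ?mulr1 ?mulr0.
Qed.

Let survE N w y := surv (sample N w) y.

(** The constant is found near the lower endpoint. For points [a j] with [F (a j)] tending to 0, the
    estimator puts little mass below a suitable [a j] for all large [N], so both [surv] and [1 - F]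
    are near 1 there; [surv_ratio_cauchy] carries the ratio from [a j] to [y]. *)
Let surv_interior y : 0 < F y < 1 ->
  {ae P, forall w, survE N w y @[N --> \oo] --> 1 - F y}.
Proof.
move=> /andP[Fy0 Fy1].
(* A divisor of at least 2 keeps [F (a j)] below [F y], hence [a j] below [y]. *)
have : forall j : nat, exists a, F a = F y / j.+2%:R.
  move=> j; apply: quantile; rewrite divr_gt0//= ltr_pdivrMr// mul1r.
  by rewrite (lt_trans Fy1)// ltr1n.
move=> /choice[a Fa].
have aj j : F (a j) <= j.+1%:R^-1.
  rewrite Fa -[leRHS]mul1r ler_pM ?invr_ge0 ?ltW//.
  by rewrite ltf_pV2 ?posrE ?ltr0n// ltr_nat.
have ay j : a j <= y.
  rewrite leNgt; apply/negP => /ltW/F_le; rewrite Fa leNgt => /negP; apply.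
  by rewrite ltr_pdivrMr// -[ltLHS]mulr1 ltr_pM2l// ltr1n.
have Fa0 j : 0 < F (a j) by rewrite Fa divr_gt0.
have tails : {ae P, forall w, forall e, 0 < e -> exists2 j, j.+1%:R^-1 <= e &
    \forall N \near \oo, estimate (sample N w) \1_`]-oo, a j[ <= e}.
  apply: (ae_estimate_small_index (phi := fun j => \1_`]-oo, a j[)).
  - by move=> j; exact: measurable_indic.
  - by move=> j x; rewrite indicE.
  - move=> j; rewrite integral_indic//.
    by rewrite setIT [X in (X <= _)%E](lebesgue_stieltjes_Nyo cF) lee_fin.
have cauchy : {ae P, forall w, forall j e, 0 < e ->
    \forall N \near \oo, `|q N w (a j) - q N w y| <= e}.
  apply/ae_foralln => j.
  exact: (surv_ratio_cauchy (G_gt0 (Fa0 j)) Fy1 (ay j)).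
apply: filterS3 no_ties tails cauchy => w Yw tw cw.
(* [e' <= 1 / 2] gives [1 - F (a j) >= 1 / 2]; the ratio is then within [2 * e'] of 1 at [a j] and
   within [3 * e'] at [y]. *)
apply/cvgrPdist_le => e e0; pose e' := Num.min (e / 8) (1 / 2).
have e'0 : 0 < e' by rewrite lt_min; apply/andP; split; lra.
have [j je tj] := tw _ e'0; apply: filterS2 tj (cw j _ e'0) => N.
rewrite estimate_ray// /q => tN cN.
have [e8 e2] : e' <= e / 8 /\ e' <= 1 / 2.
  by apply/andP; rewrite -le_min.
have S1 := surv_le1 (sample N w) (a j).
have Faj := le_trans (aj j) je.
have := Fa0 j; set c := F (a j) in Faj cN *; move=> c0.
set S := surv (sample N w) (a j) in tN S1 cN *.
rewrite /survE; set S' := surv (sample N w) y in cN *.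
have c12 : 1 / 2 <= 1 - c by lra.
have d0 : 0 < 1 - F y by lra.
have S'E : S' = S' / (1 - F y) * (1 - F y) by rewrite divfK// gt_eqF.
have SE : S = S / (1 - c) * (1 - c) by rewrite divfK// gt_eqF//; lra.
set u := S / (1 - c) in SE cN; set v := S' / (1 - F y) in S'E cN.
have u1 : `|u - 1| <= 2 * e'.
  have h : (u - 1) * (1 - c) = S - (1 - c) by rewrite mulrBl -SE mul1r.
  have h2 : `|(u - 1) * (1 - c)| <= e' by rewrite h ler_norml; apply/andP; split; lra.
  rewrite normrM (@ger0_norm _ (1 - c)) in h2; last by lra.
  have : `|u - 1| * (1 / 2) <= `|u - 1| * (1 - c) by rewrite ler_wpM2l.
  lra.
have v1 : `|v - 1| <= 3 * e'.
  have := ler_distD u v 1; rewrite [`|v - u|]distrC; lra.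
have -> : 1 - F y - S' = (1 - v) * (1 - F y) by rewrite {1}S'E; lra.
rewrite normrM (@gtr0_norm _ (1 - F y))// distrC.
have : `|v - 1| * (1 - F y) <= `|v - 1| * 1 by rewrite ler_wpM2l//; lra.
lra.
Qed.

Let consistent_ray_interior y : 0 < F y < 1 -> consistent \1_`]-oo, y[.
Proof.
move=> Fy; rewrite /consistent Rintegral_indic//.
rewrite [X in fine X](lebesgue_stieltjes_Nyo cF)/=.
apply: filterS2 no_ties (surv_interior Fy) => w Yw Sw.
under eq_fun do rewrite estimate_ray//.
rewrite (_ : F y = 1 - (1 - F y)); last by lra.
by apply: cvgB => //; exact: cvg_cst.
Qed.

(** An L^1 limit of rays with [F (y j)] tending to 1; complements in the Dynkin argument rest on
    it. *)
Let consistent_setT : consistent \1_setT.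
Proof.
have : forall j : nat, exists y, F y = 1 - j.+2%:R^-1.
  move=> j; apply: quantile.
  have : j.+2%:R^-1 < 1 :> R by rewrite invf_lt1 ?ltr1n ?ltr0n.
  have : 0 < j.+2%:R^-1 :> R by rewrite invr_gt0 ltr0n.
  set u := j.+2%:R^-1; lra.
move=> /choice[y Fy].
have y01 j : 0 < F (y j) < 1.
  rewrite Fy; have : j.+2%:R^-1 < 1 :> R by rewrite invf_lt1 ?ltr1n ?ltr0n.
  have : 0 < j.+2%:R^-1 :> R by rewrite invr_gt0 ltr0n.
  set u := j.+2%:R^-1; lra.
apply: (@consistent_lim _ (fun j => \1_`]-oo, y j[)).
- exact: indic_integrable.
- by move=> j; exact: indic_integrable.
- by move=> j; exact: consistent_ray_interior.
move=> j; rewrite (eq_integral (fun x : measurableTypeR R =>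
  (\1_`[y j, +oo[ (x : R))%:E)); last first.
  move=> x _; rewrite !indicE in_setT !mem_setE !in_itv/= andbT.
  by case: ltP => _; rewrite ?subrr ?normr0// subr0 normr1.
rewrite integral_indic// setIT [X in (X <= _)%E](lebesgue_stieltjes_cy cF) lee_fin.
rewrite Fy opprB addrC subrK lef_pV2 ?posrE ?ltr0n//.
by rewrite ler_nat.
Qed.

Let consistent_setC A : measurable A -> consistent \1_A -> consistent \1_(~` A).
Proof.
move=> mA cA; rewrite (_ : \1_(~` A) = fun y => \1_setT y + (-1) * \1_A y); last first.
  by apply/funext => y; rewrite !indicE in_setT in_setC; case: (_ \in _); rewrite /=; lra.
have iA := indic_integrable mA; apply: consistentD => //.
- exact: indic_integrable.
- exact: (integrableZl measurableT (-1) iA).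
- exact: consistentZ.
Qed.

Let consistent_ray y : consistent \1_`]-oo, y[.
Proof.
have /andP[Fy0 Fy1] := cdf_itv F y.
have [Fy_le0|Fy_gt0] := leP (F y) 0.
  apply: consistent_null => //; rewrite [LHS](lebesgue_stieltjes_Nyo cF).
  by congr (_%:E); apply/eqP; rewrite eq_le Fy_le0.
have [Fy_lt1|Fy_ge1] := ltP (F y) 1.
  by apply: consistent_ray_interior; rewrite Fy_gt0.
rewrite -setCitvr; apply: consistent_setC => //.
apply: consistent_null => //; rewrite [LHS](lebesgue_stieltjes_cy cF).
by congr (_%:E); apply/eqP; rewrite subr_eq0 eq_le Fy1 Fy_ge1.
Qed.

Let consistent_bigsetU (A : (set R)^nat) n : (forall k, measurable (A k)) ->
  trivIset setT A -> (forall k, consistent \1_(A k)) ->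
  consistent \1_(\big[setU/set0]_(k < n) A k).
Proof.
move=> mA tA cA; elim: n => [|n ih].
  by rewrite big_ord0; apply: consistent_null => //; exact: measure0.
rewrite big_ord_recr/= (_ : \1_(_ `|` _) = fun y =>
    \1_(\big[setU/set0]_(k < n) A k) y + \1_(A n) y).
  apply: consistentD => //; last exact: indic_integrable.
  by apply: indic_integrable; exact: bigsetU_measurable.
apply/funext => y; rewrite !indicE in_setU.
case: (boolP (y \in A n)) => [yn|]; last by rewrite orbF addr0.
rewrite orbT [X in (nat_of_bool X)%:R + _](_ : _ = false) ?add0r//.
apply/negP => /set_mem; rewrite -bigcup_mkord => -[k /= kn yk].
have := tA k n Logic.I Logic.I; move=> /(_ (ex_intro _ y (conj yk (set_mem yn)))) kE.
by rewrite kE ltnn in kn.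
Qed.

Let consistent_bigcup (A : (set R)^nat) : (forall k, measurable (A k)) ->
  trivIset setT A -> (forall k, consistent \1_(A k)) ->
  consistent \1_(\bigcup_k A k).
Proof.
move=> mA tA cA; have mU : measurable (\bigcup_k A k) by exact: bigcup_measurable.
pose B n := \big[setU/set0]_(k < n) A k.
have mB n : measurable (B n) by exact: bigsetU_measurable.
have BU n : B n `<=` \bigcup_k A k.
  by rewrite /B -bigcup_mkord => y [k _ ?]; exists k.
have tail : forall j : nat, exists n, (mu ((\bigcup_k A k) `\` B n) <= j.+1%:R^-1%:E)%E.
  move=> j.
  have cvgB : mu (B n) @[n --> \oo] --> mu (\bigcup_k A k).
    have <- : \bigcup_n B n = \bigcup_k A k.
      apply/seteqP; split => y; first by move=> [n _ /BU].
      move=> [k _ Aky]; exists k.+1 => //; rewrite /B -bigcup_mkord.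
      by exists k => /=.
    apply: nondecreasing_cvg_mu => //.
      by apply: bigcup_measurable => k _; exact: mB.
    by move=> m n mn; apply/subsetPset; rewrite /B -!bigcup_mkord => y [k km ?];
      exists k => //; exact: leq_trans km mn.
  have fU : mu (\bigcup_k A k) \is a fin_num by apply: fin_num_measure.
  have j0 : 0 < j.+1%:R^-1 :> R by rewrite invr_gt0 ltr0n.
  have fB n : mu (B n) \is a fin_num by apply: fin_num_measure; exact: mB.
  rewrite -(fineK fU) in cvgB.
  move/fine_cvgP : cvgB => [_ /cvgrPdist_le/(_ _ j0)[n _ /(_ n (leqnn n)) /= hn]].
  exists n; have Uoo : (mu (\bigcup_k A k) < +oo)%E by rewrite -ge0_fin_numE.
  have -> : mu (\bigcup_k A k `\` B n) = (mu (\bigcup_k A k) - mu (B n))%E.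
    rewrite [LHS](measureD (mu := lebesgue_stieltjes_measure F) mU (mB n) Uoo).
    by rewrite setIidr.
  rewrite -(fineK fU) -(fineK (fB n)) -EFinB lee_fin.
  exact: le_trans (ler_norm _) hn.
move=> /choice in tail; have [n tn] := tail.
apply: (@consistent_lim _ (fun j => \1_(B (n j)))).
- exact: indic_integrable.
- by move=> j; exact: indic_integrable.
- by move=> j; exact: consistent_bigsetU.
move=> j; rewrite (eq_integral (fun x : measurableTypeR R =>
  (\1_((\bigcup_k A k) `\` B (n j)) (x : R))%:E)).
  rewrite integral_indic//; last exact: (measurableD mU (mB _)).
  by rewrite setIT; exact: tn.
move=> x _; rewrite !indicE in_setD; congr (_%:E).
case: (boolP (x \in B _)) => [xB|_]; last by rewrite subr0 andbT ger0_norm.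
by rewrite andbF (mem_set (BU _ _ (set_mem xB))) subrr normr0.
Qed.

Lemma consistent_indic (A : set R) : measurable A -> consistent \1_A.
Proof.
move=> mA; have := @dynkin_induction _ R (@RGenInftyO.G R)
  (fun B => consistent \1_B) (RGenInftyO.measurableE R).
apply => //.
- move=> _ _ [x ->] [y ->]; exists (Num.min x y).
  by apply/seteqP; split => z /=; rewrite !in_itv/= lt_min => /andP.
- by move=> _ [y ->]; exact: consistent_ray.
by rewrite -[X in X A]/((@RGenInftyO.G R).-sigma.-measurable) -RGenInftyO.measurableE.
Qed.

Import HBSimple.

Lemma consistent_L1 phi : L1 mu phi -> consistent phi.
Proof.
move=> iphi.
have sum_ok (I : Type) (s : seq I) (c : I -> R) (A : I -> set R) :
    (forall i, measurable (A i)) ->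
    L1 mu (fun y => \sum_(i <- s) c i * \1_(A i) y) /\
    consistent (fun y => \sum_(i <- s) c i * \1_(A i) y).
  move=> mA; elim: s => [|i s [ih1 ih2]].
    under eq_fun do rewrite big_nil.
    have -> : (fun=> 0) = (\1_set0 : R -> R) by apply/funext => y; rewrite indic0.
    by split; [exact: indic_integrable|apply: consistent_null => //; exact: measure0].
  under eq_fun do rewrite big_cons.
  have iA := indic_integrable (mA i).
  have icA : L1 mu (fun y => c i * \1_(A i) y) := integrableZl measurableT (c i) iA.
  split; first exact: (integrableD measurableT icA ih1).
  apply: consistentD => //; apply: consistentZ => //; exact: consistent_indic.
have sfun_ok (f : {sfun (measurableTypeR R) >-> R}) : L1 mu f /\ consistent f.
  have fE : (f : R -> R) = fun y =>
      \sum_(r <- finmap.enum_fset (fset_set (range f))) r * \1_(f @^-1` [set r]) y.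
    by apply/funext => y; rewrite fimfunE fsbig_finite.
  rewrite fE; apply: sum_ok => r.
  exact: (measurable_funPTI f (measurable_set1 r)).
have [g [ig _ g0]] := approximation_sfun_integrable measurableT iphi.
have : forall j : nat, exists n,
    (\int[mu]_y (`|phi y - g n y|)%:E <= j.+1%:R^-1%:E)%E.
  move=> j; have j0 : 0 < j.+1%:R^-1 :> R by rewrite invr_gt0 ltr0n.
  move/fine_cvgP : g0 => [[n1 _ h1] /cvgrPdist_le/(_ _ j0)[n2 _ h2]].
  exists (maxn n1 n2).
  have := h2 _ (leq_maxr n1 n2); have /= := h1 _ (leq_maxl n1 n2).
  set I := (\int[_]_(_ in _) _)%E => If; rewrite /= sub0r normrN => In.
  rewrite -(fineK If) lee_fin; exact: le_trans (ler_norm _) In.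
move=> /choice[n gn]; apply: (consistent_lim iphi _ _ gn) => j.
- by have [] := sfun_ok (g (n j)).
- by have [] := sfun_ok (g (n j)).
Qed.

(** The sample contains the risk set at a median, whose size grows linearly in [N]. *)
Lemma sample_size_unbounded :
  {ae P, forall w, forall m, exists N, (m <= size (sample N w))%N}.
Proof.
have [|b Fb] := @quantile (1 / 2); first lra.
have Gb : 0 < G b by apply: G_gt0; lra.
have c0 : 0 < G b * (1 - F b) by rewrite mulr_gt0//; lra.
apply: filterS (mean_risk b) => w.
set c := G b * (1 - F b) in c0 *.
have c2 : 0 < c / 2 by lra.
move=> /cvgrPdist_lt/(_ _ c2)[N0 _ hN] m.
pose N := maxn N0.+1 (Num.truncn (m%:R / (c / 2))).+1.
have NR : 0 < N%:R :> R by rewrite ltr0n /N leq_max.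
have mN : m%:R < N%:R * (c / 2).
  rewrite -ltr_pdivrMr//; apply: (lt_le_trans (truncnS_gt _)).
  by rewrite ler_nat /N leq_maxr.
exists N; rewrite -(ler_nat R); apply: (le_trans (ltW mN)).
have N0N : (N0 <= N)%N by rewrite /N leq_max leqnSn.
have := hN N N0N => /=; set r := risk _ b => rc.
have {}rc : c / 2 < N%:R^-1 * r by have := ler_norm (c - N%:R^-1 * r); lra.
have {}rc : N%:R * (c / 2) <= r.
  by rewrite mulrC -ler_pdivlMr// [leRHS]mulrC ltW.
apply: (le_trans rc); rewrite /r risk_natE ler_nat -sum1_size.
by apply: leq_sum => p _; case: (_ <= _ <= _).
Qed.

End consistency.

(** * Uniform convergence over the class *)

Theorem theorem1 (R : realType) (d : measure_display)
    (Omega : measurableType d) (P : probability Omega R)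
    (F G : cumulativeBounded (0 : R) (1 : R))
    (Y T : nat -> {RV P >-> R})
    (FF : set (R -> R)) :
  continuous F -> continuous G ->
  (forall k y, cdf (Y k) y = (F y)%:E) ->
  (forall k t, cdf (T k) t = (G t)%:E) ->
  (forall k, independent_pair P (Y k) (T k)) ->
  mutually_independent P (fun k w => (Y k w, T k w) : R * R) ->
  (lower_endpoint G < upper_endpoint F)%E ->
  (lower_endpoint G <= lower_endpoint F)%E ->
  FF `<=` L1 (lebesgue_stieltjes_measure F) ->
  (forall eps : R, 0 < eps ->
    (bracketing_number (lebesgue_stieltjes_measure F) eps FF < +oo)%E) ->
  cover_cvg_ae0 P (fun n w =>
    sup_deviation
      (lebesgue_stieltjes_measure (lynden_bell (truncated_sample Y T n w)))
      (lebesgue_stieltjes_measure F) FF).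
Proof.
move=> cF cG YF TG YT indep _ GF FF1 br.
set f := fun n w => _; pose sample N w := observed_among Y T N w.
have f0 n w : (0 <= f n w)%E by rewrite /f /sup_deviation le_max lexx.
have : forall n, exists g, is_measurable_cover P (f n) g.
  by move=> n; exact: exists_measurable_cover.
move=> /choice[g hg]; exists g => //.
(* For brackets of size [1 / i.+1], [D N] is the sum of the errors at all bracket ends. The number
   of latent pairs behind the sample of size [n] is random but at least [n], so [D] enters through
   its supremum over [N >= n]. *)
have brE (i : nat) : exists D : nat -> Omega -> R,
    [/\ forall N, measurable_fun setT (D N),
        {ae P, forall w, D N w @[N --> \oo] --> 0} &
        {ae P, forall w, forall n,
          (f n w <= i.+1%:R^-1%:E + esups (fun N => (D N w)%:E) n)%E}].
  have i0 : 0 < i.+1%:R^-1 :> R by rewrite invr_gt0.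
  have [_ [m [l [u [lu FFlu]]] <-] _] := ereal_inf_lt (br _ i0).
  pose err (phi : R -> R) N w : R :=
    `|estimate (sample N w) phi - \int[lebesgue_stieltjes_measure F]_y phi y|.
  have merr phi : L1 (lebesgue_stieltjes_measure F) phi ->
      forall N, measurable_fun setT (err phi N).
    move=> /measurable_int/measurable_EFinP mphi N.
    apply: measurableT_comp => //; apply: measurable_funB => //.
    exact: measurable_estimate.
  have err_cvg phi : L1 (lebesgue_stieltjes_measure F) phi ->
      {ae P, forall w, err phi N w @[N --> \oo] --> 0}.
    move=> iphi; apply: filterS (consistent_L1 cF cG YF TG YT indep GF iphi) => w h.
    by apply/norm_cvg0P; apply/subr_cvg0.
  exists (fun N w => \sum_(k < m) (err (l k) N w + err (u k) N w)); split.
  - move=> N; apply: measurable_sum => k; have [il iu _] := lu k.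
    by apply: measurable_funD; exact: merr.
  - have : {ae P, forall w, forall k : 'I_m,
        err (l k) N w + err (u k) N w @[N --> \oo] --> 0}.
      apply: filter_forall => k; have [il iu _] := lu k.
      apply: filterS2 (err_cvg _ il) (err_cvg _ iu) => w h1 h2.
      by rewrite -[0]addr0; exact: cvgD.
    apply: filterS => w h.
    rewrite [X in _ --> X](_ : 0 = \sum_(k < m) 0); last by rewrite big1.
    by apply: (cvg_big add_continuous) => k _; exact: h.
  have unb := sample_size_unbounded cF YF TG YT indep GF.
  apply: filterS2 (no_ties cF YF indep) unb => w Yw unbw n.
  have [N nN sE] := truncated_sampleE n unbw.
  rewrite /f sE.
  have us : uniq (map fst (sample N w)) by exact: uniq_observed.
  have trs : {in sample N w, forall p, p.2 <= p.1} by exact: observed_truncated.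
  apply: (le_trans (sup_deviation_le us trs (ltW i0) lu FFlu FF1)).
  rewrite EFinD leeD2l//; apply: ereal_sup_ubound.
  by exists N.
move=> /choice in brE; have [D hD] := brE.
(* The right-hand side is measurable, so by minimality of the cover the bound on [f] passes to
   [g]. *)
have gD : {ae P, forall w, forall i n,
    (g n w <= i.+1%:R^-1%:E + esups (fun N => (D i N w)%:E) n)%E}.
  apply/ae_foralln => i; apply/ae_foralln => n; have [mD _ fD] := hD i.
  have [_ _] := hg n; apply; last by apply: filterS fD => w; apply.
  apply: emeasurable_funD => //; apply: measurable_fun_esups => N.
  by apply/measurable_EFinP.
have D0 : {ae P, forall w, forall i, D i N w @[N --> \oo] --> 0}.
  by apply/ae_foralln => i; have [] := hD i.
apply: filterS2 gD D0 => w gDw D0w.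
have gsmall (e : R) : 0 < e -> \forall n \near \oo, (g n w <= e%:E)%E.
  move=> e0; have e2 : 0 < e / 2 by lra.
  have [i _ /(_ i (leqnn i)) /= ie] := near_infty_natSinv_lt (PosNum e2).
  have /cvg_esups/fine_cvgP[Dfin /cvgrPdist_le/(_ _ e2) De] :
      (D i N w)%:E @[N --> \oo] --> 0%:E by apply: cvg_EFin (D0w i); exact: nearW.
  apply: filterS2 Dfin De => n Dn; rewrite sub0r normrN /= => De.
  apply: (le_trans (gDw i n)); rewrite -(fineK Dn) -EFinD lee_fin.
  have := ler_norm (fine (esups (fun N => (D i N w)%:E) n)).
  by move: ie De; set c := i.+1%:R^-1; set b := fine _; lra.
have g0 n : (0 <= g n w)%E by have [_ fg _] := hg n; exact: le_trans (f0 n w) (fg w).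
apply/fine_cvgP; split.
  apply: filterS (gsmall _ ltr01) => n gn.
  by rewrite ge0_fin_numE// (le_lt_trans gn)// ltry.
apply/cvgrPdist_le => e e0; apply: filterS (gsmall _ e0) => n gn.
have gfin : g n w \is a fin_num by rewrite ge0_fin_numE// (le_lt_trans gn)// ltry.
by rewrite sub0r normrN ger0_norm ?fine_ge0// -lee_fin fineK.
Qed.
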